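(* Let $A$ and $B$ be finite essential square matrices over $V$ and $W$ respectively, with entries in $\mathbb{N}$. If $A$ and $B$ are shift equivalent of lag $m$, then the C*-correspondences $X(A)$ and $X(B)$ are homotopy shift equivalent of lag $m$.
   Context: Matrices. $\mathbb{N}=\{0,1,2,\dots\}$. A matrix is essential if it has no zero row and no zero column. $A$ and $B$ are shift equivalent with lag $m\ge1$ if there are matrices $R$ ($V\times W$) and $S$ ($W\times V$) over $\mathbb{N}$ with $A^m=RS$, $B^m=SR$, $BS=SA$, $AR=RB$. Correspondences. For C*-algebras $\mathcal{A},\mathcal{B}$, an $\mathcal{A}-\mathcal{B}$ correspondence is a right Hilbert $\mathcal{B}$-module $X$ with a $*$-homomorphism $\phi_X:\mathcal{A}\to\mathcal{L}(X)$ into the adjointable operators, always assumed non-degenerate ($\phi_X(\mathcal{A})X=X$). It is full if the inner products span a dense subspace of $\mathcal{B}$, proper if $\phi_X(\mathcal{A})\subseteq\mathcal{K}(X)$ (generalized compacts), injective if $\phi_X$ is injective, regular if injective and proper. A unitary correspondence isomorphism is an inner-product-preserving surjective bimodule map. Tensor products are interior tensor products, and associativity isomorphisms are suppressed. $c(V)$ is the C*-algebra of functions on $V$. With $E_A=\{(v,k,w): v,w\in V,0\le k<A_{vw}\}$, $s(v,k,w)=v$, $r(v,k,w)=w$, $X(A)$ is the $c(V)-c(V)$ correspondence of functions $E_A\to\mathbb{C}$ with $(a\cdot\xi\cdot b)(e)=a(s(e))\xi(e)b(r(e))$ and $\langle\xi,\eta\rangle(w)=\sum_{r(e)=w}\overline{\xi(e)}\eta(e)$.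 Bicategory $\mathfrak{C}^{\mathbb{N}}_{\mathrm{pr}}$. Objects: pairs $(\mathcal{A},X)$ with $X$ a full regular correspondence over $\mathcal{A}$; here $X(A)$ stands for the object $(c(V),X(A))$. A 1-arrow $[F,\Phi_F]:(\mathcal{B},Y)\leftarrow(\mathcal{A},X)$ is a full proper $\mathcal{B}-\mathcal{A}$ correspondence $F$ with a unitary correspondence isomorphism $\Phi_F:Y\otimes_{\mathcal{B}}F\to F\otimes_{\mathcal{A}}X$. A 2-arrow $[F,\Phi_F]\to[G,\Phi_G]$ is a unitary correspondence isomorphism $\Psi:F\to G$ with $(\Psi\otimes1_X)\Phi_F=\Phi_G(1_Y\otimes\Psi)$. Composition of 1-arrows: $[G,\Phi_G]\otimes[F,\Phi_F]=[G\otimes F,\Phi_G\odot\Phi_F]$, $\Phi_G\odot\Phi_F=(1_G\otimes\Phi_F)(\Phi_G\otimes1_F)$. $[X^{\otimes m},1_{X^{\otimes m+1}}]:(\mathcal{A},X)\leftarrow(\mathcal{A},X)$ is the 1-arrow whose isomorphism is the associativity identification $X\otimes X^{\otimes m}\cong X^{\otimes m}\otimes X$. Homotopy. Let $I=[0,1]$. $C(I,X)$ is the natural correspondence over $C(I,\mathcal{A})$. For $t\in I$, $\mathcal{A}_t$ is the $C(I,\mathcal{A})-\mathcal{A}$ correspondence $\mathcal{A}$ with left action $f\cdot a=f(t)a$, and $\mathrm{ev}_t=[\mathcal{A}_t,\eta_t]:(C(I,\mathcal{A}),C(I,X))\leftarrow(\mathcal{A},X)$ with $\eta_t$ the canonical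 unitary isomorphism $C(I,X)\otimes_{C(I,\mathcal{A})}\mathcal{A}_t\to\mathcal{A}_t\otimes_{\mathcal{A}}X$ (both sides identified with $X$, via $f\otimes a\mapsto f(t)a$). For a 1-arrow $[H,\Phi_H]:(\mathcal{B},Y)\leftarrow(C(I,\mathcal{A}),C(I,X))$ put $[H_t,\Phi_{H_t}]=[H,\Phi_H]\otimes\mathrm{ev}_t$. A homotopy from $[F,\Phi_F]$ to $[G,\Phi_G]$ (1-arrows $(\mathcal{B},Y)\leftarrow(\mathcal{A},X)$) consists of such $[H,\Phi_H]$ with 2-arrows $h_0:[H_0,\Phi_{H_0}]\to[F,\Phi_F]$ and $h_1:[H_1,\Phi_{H_1}]\to[G,\Phi_G]$. Objects $(\mathcal{A},X)$ and $(\mathcal{B},Y)$ are homotopy shift equivalent with lag $m$ if there are 1-arrows $[M,\Phi_M]:(\mathcal{A},X)\leftarrow(\mathcal{B},Y)$ and $[N,\Phi_N]:(\mathcal{B},Y)\leftarrow(\mathcal{A},X)$ such that $[M\otimes N,\Phi_M\odot\Phi_N]$ is homotopic to $[X^{\otimes m},1_{X^{\otimes m+1}}]$ and $[N\otimes M,\Phi_N\odot\Phi_M]$ is homotopic to $[Y^{\otimes m},1_{Y^{\otimes m+1}}]$. *)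

(* Defs.v *)
From HB Require Import structures.
From mathcomp Require Import all_boot all_order all_algebra.
From mathcomp Require Import complex.
From mathcomp Require Import all_classical all_reals all_analysis.
From mathcomp Require Import ring lra.
Set Implicit Arguments.
Unset Strict Implicit.
Unset Printing Implicit Defensive.
Import Order.TTheory GRing.Theory Num.Theory.
Import numFieldNormedType.Exports.
Local Open Scope ring_scope.
Local Notation normc := (@ComplexField.Normc.normc _).
#[local] Obligation Tactic := idtac.

Section Banach.
Context (R : realType).
Local Notation C := R[i].

Definition seq_cauchy (M : zmodType) (N : M -> R) (u : nat -> M) : Prop :=
  forall e : R, 0 < e -> exists n0, forall m n,
    (n0 <= m)%N -> (n0 <= n)%N -> N (u m - u n) < e.

Definition seq_cvg (M : zmodType) (N : M -> R) (u : nat -> M) (l : M) : Prop :=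
  forall e : R, 0 < e -> exists n0, forall n, (n0 <= n)%N -> N (u n - l) < e.

(* A complex Banach space.  The norm is R-valued, whereas that of a
   normedModType R[i] would be R[i]-valued. *)
Record banach := Banach {
  bcar :> lmodType C;
  bnorm : bcar -> R;
  bnorm0_eq0 : forall x, bnorm x = 0 -> x = 0;
  bnormD : forall x y, bnorm (x + y) <= bnorm x + bnorm y;
  bnormZ : forall (c : C) x, bnorm (c *: x) = normc c * bnorm x;
  bcomplete : forall u : nat -> bcar, seq_cauchy bnorm u ->
    exists l, seq_cvg bnorm u l }.

Lemma normc_ge0 (z : C) : 0 <= normc z.
Proof. by case: z => a b; exact: sqrtr_ge0. Qed.

Lemma normc_real (x : R) : normc x%:C%C = `|x|.
Proof. by rewrite /= expr0n /= addr0 sqrtr_sqr. Qed.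

Lemma normc_conj (z : C) : normc (conjc z) = normc z.
Proof. by case: z => a b /=; rewrite sqrrN. Qed.

Lemma conjc_mul (z : C) : conjc z * z = (normc z ^+ 2)%:C%C.
Proof.
case: z => a b /=; rewrite sqr_sqrtr ?addr_ge0 ?sqr_ge0 //.
by apply/eqP; rewrite eq_complex /=; apply/andP; split; apply/eqP; ring.
Qed.

Lemma normc_N1 : normc (-1 : C) = 1.
Proof. by rewrite normcN ComplexField.Normc.normc1. Qed.

Section Theory.
Variable B : banach.
Implicit Types x y : B.

Lemma bnorm0 : bnorm (0 : B) = 0.
Proof. by rewrite -(scale0r (0 : B)) bnormZ ComplexField.Normc.normc0 mul0r. Qed.

Lemma bnormN x : bnorm (- x) = bnorm x.
Proof. by rewrite -scaleN1r bnormZ normc_N1 mul1r. Qed.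

Lemma bnorm_ge0 x : 0 <= bnorm x.
Proof.
have := bnormD x (- x); rewrite subrr bnorm0 bnormN -mulr2n.
by rewrite pmulrn_lge0.
Qed.

Lemma bnormB x y : bnorm (x - y) = bnorm (y - x).
Proof. by rewrite -opprB bnormN. Qed.

Lemma bnorm_tri z x y : bnorm (x - y) <= bnorm (x - z) + bnorm (z - y).
Proof. by apply: le_trans (bnormD _ _); rewrite addrA subrK. Qed.

Lemma bnorm_dist x y : `|bnorm x - bnorm y| <= bnorm (x - y).
Proof.
have h u v : bnorm u - bnorm v <= bnorm (u - v).
  by rewrite lerBlDr; apply: le_trans (bnormD _ _); rewrite subrK.
by rewrite ler_norml h andbT lerNl opprB bnormB.
Qed.

End Theory.

Lemma normc_le_sum (z : C) : normc z <= `|complex.Re z| + `|complex.Im z|.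
Proof.
case: z => a b /=.
rewrite -(@ler_pXn2r _ 2) ?nnegrE ?sqrtr_ge0 ?addr_ge0 // sqr_sqrtr ?addr_ge0 ?sqr_ge0 //.
rewrite -(real_normK (num_real a)) -(real_normK (num_real b)) sqrrD.
have : 0 <= `|a| * `|b| by rewrite mulr_ge0.
by move: (`|a|) (`|b|) => s t; nra.
Qed.

Lemma Re_le_normc (z : C) : `|complex.Re z| <= normc z.
Proof.
case: z => a b /=; rewrite -sqrtr_sqr ler_wsqrtr // lerDl sqr_ge0 //.
Qed.

Lemma Im_le_normc (z : C) : `|complex.Im z| <= normc z.
Proof.
case: z => a b /=; rewrite -sqrtr_sqr ler_wsqrtr // lerDr sqr_ge0 //.
Qed.

Lemma real_complete (u : nat -> R) : seq_cauchy (fun x : R => `|x|) u ->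
  exists l, seq_cvg (fun x : R => `|x|) u l.
Proof.
move=> uC.
have uc : cvg (u @ \oo)%classic.
  apply/cauchy_cvgP/cauchy_exP => e e0.
  have [n0 hn] := uC _ e0.
  exists (u n0); exists n0 => // n /= n0n.
  by rewrite /ball /= hn.
exists (lim (u @ \oo)%classic) => e e0.
move/cvgrPdist_lt: uc => /(_ _ e0) [n0 _ hn].
by exists n0 => n n0n; rewrite distrC; exact: hn.
Qed.

Lemma complex_complete (u : nat -> C) : seq_cauchy normc u ->
  exists l, seq_cvg normc u l.
Proof.
move=> uC.
have [a ha] : exists l, seq_cvg (fun x : R => `|x|) (fun n => complex.Re (u n)) l.
  apply: real_complete => e /uC [n0 hn]; exists n0 => m n hm hn'.
  by apply: le_lt_trans (hn _ _ hm hn'); rewrite -raddfB Re_le_normc.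
have [b hb] : exists l, seq_cvg (fun x : R => `|x|) (fun n => complex.Im (u n)) l.
  apply: real_complete => e /uC [n0 hn]; exists n0 => m n hm hn'.
  by apply: le_lt_trans (hn _ _ hm hn'); rewrite -raddfB Im_le_normc.
exists (a +i* b)%C => e e0.
have e2 : 0 < e / 2 by rewrite divr_gt0.
have [n1 h1] := ha _ e2; have [n2 h2] := hb _ e2.
exists (maxn n1 n2) => n; rewrite geq_max => /andP[k1 k2].
apply: le_lt_trans (normc_le_sum _) _; rewrite !raddfB /= (splitr e).
by rewrite ltrD ?h1 ?h2.
Qed.

Lemma ffun_complete (E : finType) (N : {ffun E -> C} -> R) :
  (forall (f : {ffun E -> C}) (e : E), normc (f e) <= N f) ->
  (forall f : {ffun E -> C}, N f <= \sum_e normc (f e)) ->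
  forall u : nat -> {ffun E -> C}, seq_cauchy N u -> exists l, seq_cvg N u l.
Proof.
move=> N1 N2 u uC.
have /choice [l hl] : forall e, exists l, seq_cvg normc (fun n => u n e) l.
  move=> e; apply: complex_complete => d /uC [n0 hn].
  exists n0 => m n hm hn'; apply: le_lt_trans (hn _ _ hm hn').
  by have := N1 (u m - u n) e; rewrite !ffunE.
exists [ffun e => l e] => d d0.
have d1 : 0 < d / #|E|.+1%:R by rewrite divr_gt0.
have /choice [n0 hn0] : forall e, exists n0, forall n, (n0 <= n)%N ->
    normc (u n e - l e) < d / #|E|.+1%:R by move=> e; exact: hl.
exists (\max_e n0 e)%N => n hn.
apply: le_lt_trans (N2 _) _.
have : \sum_e normc ((u n - [ffun e => l e]) e) <= \sum_(e : E) (d / #|E|.+1%:R).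
  apply: ler_sum => e _; rewrite !ffunE; apply/ltW/hn0.
  exact: leq_trans (leq_bigmax e) hn.
move/le_lt_trans; apply.
rewrite sumr_const -(mulr_natl (d / _)) mulrA ltr_pdivrMr ?ltr0n // mulrC ltr_pM2l //.
by rewrite ltr_nat.
Qed.

Lemma normc_sum (E : Type) (r : seq E) (P : pred E) (f : E -> C) :
  normc (\sum_(e <- r | P e) f e) <= \sum_(e <- r | P e) normc (f e).
Proof.
elim/big_rec2: _ => [|e x y _ h]; first by rewrite ComplexField.Normc.normc0.
by apply: le_trans (le_normcD _ _) _; rewrite lerD2l.
Qed.

Lemma sqrt_sum_tri (E : finType) (P : pred E) (a b : E -> R) (s t : R) :
  (forall e, 0 <= a e) -> (forall e, 0 <= b e) -> 0 <= s -> 0 <= t ->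
  \sum_(e | P e) a e ^+ 2 <= s ^+ 2 -> \sum_(e | P e) b e ^+ 2 <= t ^+ 2 ->
  \sum_(e | P e) (a e + b e) ^+ 2 <= (s + t) ^+ 2.
Proof.
move=> a0 b0 s0 t0 hs ht.
have z (f : E -> R) : \sum_(e | P e) f e ^+ 2 <= 0 ^+ 2 ->
    forall e, P e -> f e = 0.
  rewrite expr0n /= => h e Pe; apply/eqP; rewrite -sqrf_eq0; apply/eqP.
  apply: (psumr_eq0P (F := fun e => f e ^+ 2)) Pe => [i _|]; first exact: sqr_ge0.
  by apply/eqP; rewrite eq_le h sumr_ge0 // => i _; exact: sqr_ge0.
have [s1|s1] := eqVneq s 0.
  move: hs; rewrite s1 => /z hs; rewrite add0r.
  by under eq_bigr => e Pe do rewrite hs // add0r.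
have [t1|t1] := eqVneq t 0.
  move: ht; rewrite t1 => /z ht; rewrite addr0.
  by under eq_bigr => e Pe do rewrite ht // addr0.
have s2 : 0 < s by rewrite lt_def s1.
have t2 : 0 < t by rewrite lt_def t1.
apply: le_trans (_ : \sum_(e | P e) ((1 + t / s) * a e ^+ 2 + (1 + s / t) * b e ^+ 2) <= _).
  apply: ler_sum => e _.
  have : 0 <= (t * a e - s * b e) ^+ 2 / (s * t) by rewrite divr_ge0 ?sqr_ge0 ?mulr_ge0.
  suff -> : (t * a e - s * b e) ^+ 2 / (s * t) =
     t / s * a e ^+ 2 + s / t * b e ^+ 2 - 2 * a e * b e by lra.
  by field; rewrite s1 t1.
rewrite big_split -!mulr_sumr /=.
have -> : (s + t) ^+ 2 = (1 + t / s) * s ^+ 2 + (1 + s / t) * t ^+ 2.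
  by field; rewrite s1 t1.
by apply: lerD; rewrite ler_wpM2l // addr_ge0 // divr_ge0.
Qed.

End Banach.

Section Paths.
Context (R : realType).
Local Notation C := R[i].

Definition unitI := {t : R | 0 <= t <= 1}.

Definition path_continuous (B : banach R) (f : unitI -> B) : Prop :=
  forall (t : unitI) (e : R), 0 < e -> exists2 d : R, 0 < d &
    forall s : unitI, `|sval s - sval t| < d -> bnorm (f s - f t) < e.

Lemma clamp_subproof (x : R) : 0 <= Num.max 0 (Num.min 1 x) <= 1.
Proof. by rewrite le_max lexx /= ge_max ler01 /= ge_min lexx. Qed.

Definition clamp (x : R) : unitI :=
  exist (fun t : R => is_true (0 <= t <= 1)) _ (clamp_subproof x).

Lemma clampK (t : unitI) : clamp (sval t) = t.
Proof.
apply: val_inj => /=; case: t => t /= /andP[t0 t1].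
by rewrite (min_idPr t1) (max_idPr t0).
Qed.

Lemma clamp_dist (x y : R) : `|sval (clamp x) - sval (clamp y)| <= `|x - y|.
Proof.
have clampE z : sval (clamp z) = if z <= 0 then 0 else if 1 <= z then 1 else z.
  rewrite /=; case: ifPn; rewrite -?ltNge => z0.
    by rewrite (min_idPr _) ?(max_idPl _) // (le_trans z0).
  case: ifPn; rewrite -?ltNge => z1; first by rewrite (min_idPl z1) (max_idPr ler01).
  by rewrite (min_idPr (ltW z1)) (max_idPr (ltW z0)).
rewrite !clampE ler_norml; have /ler_normlP[n1 n2] := lexx `|x - y|.
by apply/andP; split; do ![case: ifPn; rewrite -?ltNge => ?]; lra.
Qed.

Lemma unitI_max (g : unitI -> R) :
  (forall (t : unitI) (e : R), 0 < e -> exists2 d : R, 0 < d &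
    forall s : unitI, `|sval s - sval t| < d -> `|g s - g t| < e) ->
  exists t, forall s, g s <= g t.
Proof.
move=> gc.
have cont : ({within `[0, 1], continuous (fun x : R => g (clamp x))})%classic.
  apply: continuous_subspaceT => x.
  apply/cvgrPdist_lt => e e0.
  have [d d0 hd] := gc (clamp x) e e0.
  exists d => //= y xy; rewrite distrC; apply: hd.
  by apply: le_lt_trans (clamp_dist _ _) _; rewrite distrC.
have [c _ hc] := EVT_max ler01 cont.
exists (clamp c) => s; rewrite -{1}(clampK s); apply: hc.
by rewrite in_itv /=; exact: (svalP s).
Qed.

Section PathSpace.
Variable B : banach R.

Definition is_path : {pred unitI -> B} := fun f => `[< path_continuous f >].

Lemma is_path_submod : submod_closed is_path.
Proof.
split=> [|c f g /asboolP cf /asboolP cg]; apply/asboolP => t e e0.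
  by exists 1 => // s _; rewrite subrr bnorm0.
have d0 : 0 < e / 2 / (1 + normc c) by rewrite !divr_gt0 // ltr_wpDr // normc_ge0.
have [d1 p1 h1] := cf t _ d0.
have [d2 p2 h2] := cg t (e / 2) ltac:(by rewrite divr_gt0).
exists (Num.min d1 d2); first by rewrite lt_min p1.
move=> s; rewrite lt_min => /andP[k1 k2].
have -> : (c *: f + g) s - (c *: f + g) t = c *: (f s - f t) + (g s - g t).
  rewrite -[(c *: f + g) s]/(c *: f s + g s) -[(c *: f + g) t]/(c *: f t + g t).
  by rewrite scalerBr opprD addrACA.
apply: le_lt_trans (bnormD _ _) _; rewrite (splitr e) ler_ltD ?h2 // bnormZ.
have := h1 s k1; move: (bnorm _) (bnorm_ge0 (f s - f t)) => x x0 hx.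
have c0 := normc_ge0 c.
apply: le_trans (_ : (1 + normc c) * x <= _).
  by rewrite mulrDl mul1r lerDr.
by rewrite mulrC -ler_pdivlMr ?ltW // ltr_wpDr.
Qed.

HB.instance Definition _ := GRing.isSubmodClosed.Build C (unitI -> B) is_path
  is_path_submod.

Record cpath := CPath { cpath_fun :> unitI -> B; cpathP : cpath_fun \in is_path }.

HB.instance Definition _ := [isSub for cpath_fun].
HB.instance Definition _ := [Choice of cpath by <:].
HB.instance Definition _ := [SubChoice_isSubLmodule of cpath by <:].

Lemma cpath_cont (f : cpath) : path_continuous f.
Proof. exact/asboolP/cpathP. Qed.

Definition mk_cpath (f : unitI -> B) (h : path_continuous f) : cpath :=
  CPath (asboolT h).

Lemma cpath_ext (f g : cpath) : (forall t, f t = g t) -> f = g.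
Proof. by move=> h; apply/val_inj/funext. Qed.

Lemma cpathD (f g : cpath) t : (f + g) t = f t + g t.
Proof. by []. Qed.

Lemma cpathN (f : cpath) t : (- f) t = - f t.
Proof. by []. Qed.

Lemma cpathZ c (f : cpath) t : (c *: f) t = c *: f t.
Proof. by []. Qed.

Definition cpath_norm (f : cpath) : R := sup [set bnorm (f t) | t in [set: unitI]]%classic.

Lemma cpath_norm_attained (f : cpath) :
  exists2 t, cpath_norm f = bnorm (f t) & forall s, bnorm (f s) <= bnorm (f t).
Proof.
have [|t ht] := unitI_max (g := fun t => bnorm (f t)).
  move=> t e e0; have [d d0 hd] := cpath_cont f t e0.
  by exists d => // s /hd; exact: le_lt_trans (bnorm_dist _ _).
exists t => //; apply/eqP; rewrite eq_le; apply/andP; split.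
  by apply: ge_sup => [|_ [s _ <-]]; [exists (bnorm (f t)), t|exact: ht].
by apply: ub_le_sup => [|]; [exists (bnorm (f t)) => _ [s _ <-]; exact: ht|exists t].
Qed.

Lemma cpath_norm_ge (f : cpath) t : bnorm (f t) <= cpath_norm f.
Proof. by have [s ->] := cpath_norm_attained f. Qed.

Lemma cpath_norm_le (f : cpath) M :
  (forall t, bnorm (f t) <= M) -> cpath_norm f <= M.
Proof. by have [s ->] := cpath_norm_attained f. Qed.

Lemma cpath_norm_lt (f : cpath) M :
  (forall t, bnorm (f t) < M) -> cpath_norm f < M.
Proof. by have [s ->] := cpath_norm_attained f. Qed.

Lemma cpath_norm0_eq0 f : cpath_norm f = 0 -> f = 0.
Proof.
move=> f0; apply: cpath_ext => t; apply: bnorm0_eq0; apply/eqP.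
by rewrite eq_le bnorm_ge0 andbT -f0 cpath_norm_ge.
Qed.

Lemma cpath_normD f g : cpath_norm (f + g) <= cpath_norm f + cpath_norm g.
Proof.
apply: cpath_norm_le => t; apply: le_trans (bnormD _ _) _.
by rewrite lerD ?cpath_norm_ge.
Qed.

Lemma cpath_normZ c f : cpath_norm (c *: f) = normc c * cpath_norm f.
Proof.
apply/eqP; rewrite eq_le; apply/andP; split.
  apply: cpath_norm_le => t; rewrite cpathZ bnormZ.
  by rewrite ler_wpM2l ?normc_ge0 ?cpath_norm_ge.
have [t -> _] := cpath_norm_attained f.
by rewrite -bnormZ -cpathZ cpath_norm_ge.
Qed.

Lemma seq_cvg_limit_cauchy (u : nat -> B) l e n0 :
  (forall n m, (n0 <= n)%N -> (n0 <= m)%N -> bnorm (u n - u m) < e) ->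
  seq_cvg (@bnorm R B) u l -> forall n, (n0 <= n)%N -> bnorm (u n - l) <= e.
Proof.
move=> h ul n hn; apply/ler_addgt0Pr => d d0.
have [n1 h1] := ul _ d0.
apply: le_trans (bnorm_tri (u (maxn n0 n1)) _ _) _.
by rewrite lerD // ltW ?h ?h1 ?leq_maxl ?leq_maxr.
Qed.

Lemma cpath_complete (u : nat -> cpath) : seq_cauchy cpath_norm u ->
  exists l, seq_cvg cpath_norm u l.
Proof.
move=> uC.
have /choice [l hl] : forall t, exists l, seq_cvg (@bnorm R B) (fun n => u n t) l.
  move=> t; apply: bcomplete => e /uC [n0 hn]; exists n0 => m n hm hn'.
  by apply: le_lt_trans (hn _ _ hm hn'); exact: cpath_norm_ge (u m - u n) t.
have unif e : 0 < e -> exists n0, forall n t, (n0 <= n)%N -> bnorm (u n t - l t) <= e.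
  move=> /uC [n0 hn]; exists n0 => n t; apply: seq_cvg_limit_cauchy (hl t) n.
  move=> n m k1 k2; apply: le_lt_trans (hn _ _ k1 k2).
  exact: cpath_norm_ge (u n - u m) t.
have lc : path_continuous l.
  move=> t e e0.
  have e4 : 0 < e / 4 by rewrite divr_gt0.
  have [n0 hn] := unif _ e4.
  have [d d0 hd] := cpath_cont (u n0) t e4.
  exists d => // s /hd h.
  have h1 := hn n0 s (leqnn _); have h2 := hn n0 t (leqnn _).
  have := bnorm_tri (u n0 s) (l s) (l t).
  have := bnorm_tri (u n0 t) (u n0 s) (l t).
  rewrite bnormB in h1; lra.
exists (mk_cpath lc) => e e0.
have [n0 hn] := unif (e / 2) ltac:(by rewrite divr_gt0).
exists n0 => n n0n; apply: cpath_norm_lt => t.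
by apply: le_lt_trans (hn n t n0n) _; lra.
Qed.

Definition path_banach : banach R :=
  Banach cpath_norm0_eq0 cpath_normD cpath_normZ cpath_complete.

End PathSpace.

Lemma bilin_continuous (B1 B2 B3 : banach R) (k : R) (m : B1 -> B2 -> B3) :
  (forall x x' y, m (x - x') y = m x y - m x' y) ->
  (forall x y y', m x (y - y') = m x y - m x y') ->
  (forall x y, bnorm (m x y) <= k * (bnorm x * bnorm y)) ->
  forall (f : cpath B1) (g : cpath B2), path_continuous (fun t => m (f t) (g t)).
Proof.
move=> mBl mBr mk f g t e e0.
pose K := `|k| + 1; pose a := bnorm (f t) + 1; pose b := bnorm (g t) + 1.
have K0 : 0 < K by rewrite ltr_wpDl.
have a0 : 0 < a by rewrite ltr_wpDl ?bnorm_ge0.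
have b0 : 0 < b by rewrite ltr_wpDl ?bnorm_ge0.
have mK x y : bnorm (m x y) <= K * (bnorm x * bnorm y).
  apply: le_trans (mk x y) _; rewrite ler_wpM2r ?mulr_ge0 ?bnorm_ge0 //.
  by apply: le_trans (ler_norm k) _; rewrite lerDl.
have [d1 p1 h1] := cpath_cont f t (e := e / 2 / (K * b)) ltac:(by rewrite !divr_gt0 ?mulr_gt0).
have [d2 p2 h2] := cpath_cont g t (e := Num.min 1 (e / 2 / (K * a)))
  ltac:(by rewrite lt_min ltr01 !divr_gt0 ?mulr_gt0).
exists (Num.min d1 d2); first by rewrite lt_min p1.
move=> s; rewrite lt_min => /andP[/h1 k1 /h2].
rewrite lt_min => /andP[k2 k3].
have gs : bnorm (g s) <= b.
  by have := bnorm_dist (g s) (g t); rewrite ler_norml /b; lra.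
apply: le_lt_trans (bnorm_tri (m (f t) (g s)) _ _) _.
rewrite -mBl -mBr (splitr e); apply: ltr_leD.
  apply: le_lt_trans (mK _ _) _.
  apply: le_lt_trans (_ : bnorm (f s - f t) * (K * b) < _).
    by rewrite mulrCA ler_wpM2l ?bnorm_ge0 // ler_wpM2l // ltW.
  by rewrite -ltr_pdivlMr ?mulr_gt0.
apply: le_trans (mK _ _) _.
apply: le_trans (_ : bnorm (g s - g t) * (K * a) <= _).
  rewrite mulrA [leRHS]mulrC ler_wpM2r ?bnorm_ge0 // ler_wpM2l ?(ltW K0) //.
  by rewrite lerDl.
by rewrite -ler_pdivlMr ?mulr_gt0 // ltW.
Qed.

End Paths.

Section CStarAlgebras.
Context (R : realType).
Local Notation C := R[i].

(* [b] is the inverse of [1 - a], shifted: [(1 - a) (1 - b) = 1 = (1 - b) (1 - a)]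
   in the unitization. *)
Definition quasi_inverse (M : zmodType) (mul : M -> M -> M) (a b : M) : Prop :=
  a + b = mul a b /\ a + b = mul b a.

(* Self-adjoint with spectrum in [0, +oo[.  A scalar l != 0 is in the spectrum
   of [a] (computed in the unitization) iff [l^-1 *: a] has no quasi-inverse. *)
Definition positive_in (M : lmodType C) (mul : M -> M -> M) (star : M -> M)
    (a : M) : Prop :=
  star a = a /\ forall l : C, l != 0 ->
    ~ (exists b, quasi_inverse mul (l^-1 *: a) b) -> 0 <= l.

(* C*-algebras, not necessarily unital.  The last axiom is a consequence of the
   others (Kelley-Vaught, Kaplansky); it is among the axioms of Gelfand and
   Naimark. *)
Record cstar := CStar {
  cs_sp :> banach R;
  cmul : cs_sp -> cs_sp -> cs_sp;
  cadj : cs_sp -> cs_sp;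
  cmulDl : forall a b c, cmul (a + b) c = cmul a c + cmul b c;
  cmulDr : forall a b c, cmul a (b + c) = cmul a b + cmul a c;
  cmulZl : forall (l : C) a b, cmul (l *: a) b = l *: cmul a b;
  cmulZr : forall (l : C) a b, cmul a (l *: b) = l *: cmul a b;
  cmulA : forall a b c, cmul a (cmul b c) = cmul (cmul a b) c;
  cadjD : forall a b, cadj (a + b) = cadj a + cadj b;
  cadjZ : forall (l : C) a, cadj (l *: a) = conjc l *: cadj a;
  cadjM : forall a b, cadj (cmul a b) = cmul (cadj b) (cadj a);
  cadjK : forall a, cadj (cadj a) = a;
  cnormM : forall a b, bnorm (cmul a b) <= bnorm a * bnorm b;
  cnorm_star : forall a, bnorm (cmul (cadj a) a) = bnorm a ^+ 2;
  cadj_mul_pos : forall a, positive_in cmul cadj (cmul (cadj a) a) }.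

Definition positive (A : cstar) (a : A) : Prop := positive_in (@cmul A) (@cadj A) a.

Section Theory.
Variable A : cstar.
Implicit Types a b c : A.

Lemma cmul0r a : cmul 0 a = 0.
Proof. by have := cmulZl 0 (0 : A) a; rewrite !scale0r. Qed.
Lemma cmulr0 a : cmul a 0 = 0.
Proof. by have := cmulZr 0 a (0 : A); rewrite !scale0r. Qed.
Lemma cmulNr a b : cmul (- a) b = - cmul a b.
Proof. by rewrite -scaleN1r cmulZl scaleN1r. Qed.
Lemma cmulrN a b : cmul a (- b) = - cmul a b.
Proof. by rewrite -scaleN1r cmulZr scaleN1r. Qed.
Lemma cmulBl a b c : cmul (a - b) c = cmul a c - cmul b c.
Proof. by rewrite cmulDl cmulNr. Qed.
Lemma cmulBr a b c : cmul a (b - c) = cmul a b - cmul a c.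
Proof. by rewrite cmulDr cmulrN. Qed.
Lemma cadjN a : cadj (- a) = - cadj a.
Proof. by rewrite -scaleN1r cadjZ rmorphN1 scaleN1r. Qed.
Lemma cadjB a b : cadj (a - b) = cadj a - cadj b.
Proof. by rewrite cadjD cadjN. Qed.

Lemma cadj_norm a : bnorm (cadj a) = bnorm a.
Proof.
have h b : bnorm b <= bnorm (cadj b).
  have [->|b0] := eqVneq (bnorm b) 0; first exact: bnorm_ge0.
  have b1 : 0 < bnorm b by rewrite lt_def b0 bnorm_ge0.
  by rewrite -(ler_pM2r b1) -expr2 -cnorm_star cnormM.
by apply/eqP; rewrite eq_le -{2}(cadjK a) !h.
Qed.

Lemma quasi_inverse_diff a b a' b' :
  quasi_inverse (@cmul A) a b -> quasi_inverse (@cmul A) a' b' ->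
  b - b' = cmul b (a - a') + cmul (a - a') b' - (a - a')
           - cmul (cmul b (a - a')) b'.
Proof.
move=> [h1 h2] [h3 h4].
have e1 : cmul b (a - a') = a + b - cmul b a' by rewrite cmulBr -h2.
have e2 : cmul (a - a') b' = cmul a b' - (a' + b') by rewrite cmulBl -h3.
have e3 : cmul (cmul b (a - a')) b' = cmul a b' - cmul b a'.
  by rewrite e1 cmulBl cmulDl -cmulA -h3 cmulDr opprD addrACA subrr addr0.
rewrite e3 e1 e2; move: (cmul b a') (cmul a b') => x y.
rewrite [y - (a' + b')]addrC [a + b - x + _]addrACA [- x + y]addrC opprD [a + b + _]addrACA.
by rewrite [_ - (a - a')]addrAC [a - a' + _]addrC !addrK.
Qed.

Lemma quasi_inverse_uniq a b b' :
  quasi_inverse (@cmul A) a b -> quasi_inverse (@cmul A) a b' -> b = b'.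
Proof.
move=> h h'; apply/eqP; rewrite -subr_eq0; apply/eqP.
by rewrite (quasi_inverse_diff h h') subrr !(cmulr0, cmul0r) !subr0 addr0.
Qed.

End Theory.

Section PathCStar.
Variable A : cstar.
Local Notation IA := (path_banach A).

Lemma path_continuous_quasi_inverse (f : IA) (b : unitI R -> A) :
  (forall t, quasi_inverse (@cmul A) (f t) (b t)) -> path_continuous b.
Proof.
move=> hb t e e0.
pose K := 1 + bnorm (b t).
have K0 : 0 < K by rewrite ltr_pwDl ?bnorm_ge0.
pose e' := Num.min (1 / (2 * K)) (e / (2 * K ^+ 2)).
have e'0 : 0 < e' by rewrite lt_min !divr_gt0 ?mulr_gt0 ?exprn_gt0.
have [d d0 hd] := cpath_cont f t e'0.
exists d => // s /hd; set D := f s - f t.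
rewrite lt_min => /andP[D1 D2].
have dif := quasi_inverse_diff (hb s) (hb t).
have n1 : bnorm (b s - b t) <= bnorm D * (1 + bnorm (b s)) * K.
  rewrite dif -/D.
  apply: le_trans (bnormD _ _) _; rewrite bnormN.
  have k1 := cnormM (b s) D; have k2 := cnormM D (b t).
  have k3 : bnorm (cmul (cmul (b s) D) (b t)) <= bnorm (b s) * bnorm D * bnorm (b t).
    by apply: le_trans (cnormM _ _) _; rewrite ler_wpM2r ?bnorm_ge0.
  have k4 := bnormD (cmul (b s) D + cmul D (b t)) (- D).
  have k5 := bnormD (cmul (b s) D) (cmul D (b t)).
  rewrite bnormN in k4; rewrite /K.
  have -> : bnorm D * (1 + bnorm (b s)) * (1 + bnorm (b t)) =
    bnorm (b s) * bnorm D + bnorm D * bnorm (b t) + bnorm D +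
    bnorm (b s) * bnorm D * bnorm (b t) by ring.
  lra.
have n2 : bnorm (b s) <= bnorm (b s - b t) + bnorm (b t).
  by apply: le_trans (bnormD _ _); rewrite subrK.
have DK : bnorm D * K < 1 / 2.
  by rewrite -ltr_pdivlMr //; move: D1; rewrite invfM mulrA.
have n3 : 1 + bnorm (b s) <= 2 * K.
  have : bnorm D * (1 + bnorm (b s)) * K <= (1 + bnorm (b s)) / 2.
    rewrite mulrAC [leRHS]mulrC ler_wpM2r ?addr_ge0 ?bnorm_ge0 //.
    by apply: ltW; move: DK; lra.
  rewrite /K in n1 n2 *; lra.
apply: le_lt_trans n1 _.
apply: le_lt_trans (_ : bnorm D * (2 * K ^+ 2) < _).
  rewrite -mulrA ler_wpM2l ?bnorm_ge0 // expr2 mulrA ler_wpM2r // ltW //.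
by rewrite -ltr_pdivlMr // mulr_gt0 ?exprn_gt0.
Qed.

Lemma path_cmul_cont (f g : IA) : path_continuous (fun t => cmul (f t) (g t)).
Proof.
apply: (bilin_continuous (k := 1)) => [x x' y|x y y'|x y].
- exact: cmulBl.
- exact: cmulBr.
- by rewrite mul1r cnormM.
Qed.

Lemma path_cadj_cont (f : IA) : path_continuous (fun t => cadj (f t)).
Proof.
move=> t e e0; have [d d0 hd] := cpath_cont f t e0.
by exists d => // s /hd; rewrite -cadjB cadj_norm.
Qed.

Definition path_cmul (f g : IA) : IA := mk_cpath (path_cmul_cont f g).
Definition path_cadj (f : IA) : IA := mk_cpath (path_cadj_cont f).

Lemma path_positive (f : IA) :
  (forall t, positive (f t)) -> positive_in path_cmul path_cadj f.
Proof.
move=> fp; split; first by apply: (@cpath_ext _ A) => t; exact: (fp t).1.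
move=> l l0 nb; apply: contrapT => nl; apply: nb.
have /choice [b hb] : forall t, exists b, quasi_inverse (@cmul A) (l^-1 *: f t) b.
  by move=> t; apply: contrapT => /((fp t).2 l l0) /nl.
have bc := @path_continuous_quasi_inverse (l^-1 *: f) b hb.
exists (mk_cpath bc); split.
  by apply: (@cpath_ext _ A) => t; exact: (hb t).1.
by apply: (@cpath_ext _ A) => t; exact: (hb t).2.
Qed.

Program Definition path_cstar : cstar :=
  @CStar IA path_cmul path_cadj _ _ _ _ _ _ _ _ _ _ _ _.
Next Obligation. by move=> *; apply: (@cpath_ext _ A) => t; exact: cmulDl. Qed.
Next Obligation. by move=> *; apply: (@cpath_ext _ A) => t; exact: cmulDr. Qed.
Next Obligation. by move=> *; apply: (@cpath_ext _ A) => t; exact: cmulZl. Qed.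
Next Obligation. by move=> *; apply: (@cpath_ext _ A) => t; exact: cmulZr. Qed.
Next Obligation. by move=> *; apply: (@cpath_ext _ A) => t; exact: cmulA. Qed.
Next Obligation. by move=> *; apply: (@cpath_ext _ A) => t; exact: cadjD. Qed.
Next Obligation. by move=> *; apply: (@cpath_ext _ A) => t; exact: cadjZ. Qed.
Next Obligation. by move=> *; apply: (@cpath_ext _ A) => t; exact: cadjM. Qed.
Next Obligation. by move=> *; apply: (@cpath_ext _ A) => t; exact: cadjK. Qed.
Next Obligation.
move=> a b; apply: cpath_norm_le => t; apply: le_trans (cnormM _ _) _.
by apply: ler_pM; rewrite ?bnorm_ge0 ?cpath_norm_ge.
Qed.
Next Obligation.
move=> a; have [t e h] := cpath_norm_attained a.
apply/eqP; rewrite eq_le; apply/andP; split.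
  apply: cpath_norm_le => s; rewrite cnorm_star.
  by rewrite ler_pXn2r ?nnegrE ?bnorm_ge0 ?cpath_norm_ge // (le_trans (bnorm_ge0 (a s))) ?cpath_norm_ge.
rewrite -[bnorm a]/(cpath_norm a) e -cnorm_star.
exact: (cpath_norm_ge (path_cmul (path_cadj a) a) t).
Qed.
Next Obligation. by move=> a; apply: path_positive => t; exact: cadj_mul_pos. Qed.

End PathCStar.

Section FunctionAlgebra.
Variable V : finType.
Implicit Types a b : {ffun V -> C}.

Definition fun_norm a : R := \big[Num.max/0]_v normc (a v).

Lemma fun_norm_ge a v : normc (a v) <= fun_norm a.
Proof. by rewrite /fun_norm (bigD1 v) //= le_max lexx. Qed.

Lemma fun_norm_ge0 a : 0 <= fun_norm a.
Proof. by rewrite /fun_norm; elim/big_rec: _ => // i x _ x0; rewrite le_max x0 orbT. Qed.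

Lemma fun_norm_le a M : 0 <= M -> (forall v, normc (a v) <= M) -> fun_norm a <= M.
Proof.
move=> M0 h; rewrite /fun_norm; elim/big_rec: _ => // i x _ x0.
by rewrite ge_max x0 h.
Qed.

Lemma fun_norm0_eq0 a : fun_norm a = 0 -> a = 0.
Proof.
move=> a0; apply/ffunP => v; rewrite ffunE; apply: ComplexField.Normc.eq0_normc.
by apply/eqP; rewrite eq_le normc_ge0 andbT -a0 fun_norm_ge.
Qed.

Lemma fun_normD a b : fun_norm (a + b) <= fun_norm a + fun_norm b.
Proof.
apply: fun_norm_le => [|v]; first by rewrite addr_ge0 ?fun_norm_ge0.
by rewrite ffunE; apply: le_trans (le_normcD _ _) _; rewrite lerD ?fun_norm_ge.
Qed.

Lemma fun_normZ c a : fun_norm (c *: a) = normc c * fun_norm a.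
Proof.
rewrite /fun_norm; elim/big_rec2: _ => [|v x y _ ->]; first by rewrite mulr0.
by rewrite ffunE ComplexField.Normc.normcM maxr_pMr ?normc_ge0.
Qed.

Lemma fun_complete (u : nat -> {ffun V -> C}) :
  seq_cauchy fun_norm u -> exists l, seq_cvg fun_norm u l.
Proof.
apply: ffun_complete => [f e|f]; first exact: fun_norm_ge.
apply: fun_norm_le => [|v]; first by apply: sumr_ge0 => v _; exact: normc_ge0.
by rewrite (bigD1 v) //= lerDl sumr_ge0 // => w _; exact: normc_ge0.
Qed.

Definition fun_banach : banach R :=
  Banach fun_norm0_eq0 fun_normD fun_normZ fun_complete.

Definition fun_mul a b : {ffun V -> C} := [ffun v => a v * b v].
Definition fun_adj a : {ffun V -> C} := [ffun v => conjc (a v)].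

Lemma fun_positive a : (forall v, 0 <= a v) -> positive_in fun_mul fun_adj a.
Proof.
move=> a0; split; first by apply/ffunP => v; rewrite ffunE; apply/CrealP/ger0_real.
move=> l l0 nb; apply: contrapT => nl; apply: nb.
have x1 v : l^-1 * a v - 1 != 0.
  rewrite subr_eq0; apply/eqP => h; apply: nl.
  by have -> : l = a v by rewrite -[l]mulr1 -h mulVKf.
exists [ffun v => (l^-1 * a v) / (l^-1 * a v - 1)].
split; apply/ffunP => v; rewrite !ffunE; have := x1 v.
  by rewrite -[l^-1 *: a v]/(l^-1 * a v); move: (l^-1 * a v) => x h; field.
by rewrite -[l^-1 *: a v]/(l^-1 * a v); move: (l^-1 * a v) => x h; field.
Qed.

Program Definition fun_cstar : cstar :=
  @CStar fun_banach fun_mul fun_adj _ _ _ _ _ _ _ _ _ _ _ _.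
Next Obligation. by move=> *; apply/ffunP => v; rewrite !ffunE mulrDl. Qed.
Next Obligation. by move=> *; apply/ffunP => v; rewrite !ffunE mulrDr. Qed.
Next Obligation. by move=> *; apply/ffunP => v; rewrite !ffunE; exact: (esym (mulrA _ _ _)). Qed.
Next Obligation. by move=> *; apply/ffunP => v; rewrite !ffunE; exact: mulrCA. Qed.
Next Obligation. by move=> *; apply/ffunP => v; rewrite !ffunE mulrA. Qed.
Next Obligation. by move=> *; apply/ffunP => v; rewrite !ffunE rmorphD. Qed.
Next Obligation. by move=> *; apply/ffunP => v; rewrite !ffunE rmorphM. Qed.
Next Obligation. by move=> *; apply/ffunP => v; rewrite !ffunE rmorphM mulrC. Qed.
Next Obligation. by move=> *; apply/ffunP => v; rewrite !ffunE conjcK. Qed.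
Next Obligation.
move=> a b; apply: fun_norm_le => [|v]; first by rewrite mulr_ge0 ?fun_norm_ge0.
by rewrite ffunE ComplexField.Normc.normcM ler_pM ?normc_ge0 ?fun_norm_ge.
Qed.
Next Obligation.
move=> a; have sq v : normc (fun_mul (fun_adj a) a v) = normc (a v) ^+ 2.
  by rewrite !ffunE ComplexField.Normc.normcM normc_conj expr2.
apply/eqP; rewrite eq_le; apply/andP; split.
  apply: fun_norm_le => [|v]; first by rewrite exprn_ge0 ?fun_norm_ge0.
  by rewrite sq ler_pXn2r ?nnegrE ?normc_ge0 ?fun_norm_ge0 ?fun_norm_ge.
rewrite -ler_sqrt ?fun_norm_ge0 // sqrtr_sqr ger0_norm ?fun_norm_ge0 //.
apply: fun_norm_le => [|v]; first exact: sqrtr_ge0.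
rewrite -[leLHS]ger0_norm ?normc_ge0 // -sqrtr_sqr -sq.
by rewrite ler_wsqrtr // fun_norm_ge.
Qed.
Next Obligation.
move=> a; apply: fun_positive => v; rewrite !ffunE mulrC -sqr_normc.
exact: exprn_ge0.
Qed.
End FunctionAlgebra.
End CStarAlgebras.

Section HilbertModules.
Context (R : realType).
Local Notation C := R[i].

(* Right Hilbert A-modules: Banach spaces whose norm is the one induced by the
   inner product. *)
Record hilbert (A : cstar R) := Hilbert {
  hsp :> banach R;
  ract : hsp -> A -> hsp;
  ip : hsp -> hsp -> A;
  ractDl : forall x y a, ract (x + y) a = ract x a + ract y a;
  ractDr : forall x a b, ract x (a + b) = ract x a + ract x b;
  ractZl : forall (c : C) x a, ract (c *: x) a = c *: ract x a;
  ractZr : forall (c : C) x a, ract x (c *: a) = c *: ract x a;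
  ractM : forall x a b, ract x (cmul a b) = ract (ract x a) b;
  ipDr : forall x y z, ip x (y + z) = ip x y + ip x z;
  ipZr : forall (c : C) x y, ip x (c *: y) = c *: ip x y;
  ipMr : forall x y a, ip x (ract y a) = cmul (ip x y) a;
  ipC : forall x y, cadj (ip x y) = ip y x;
  ip_pos : forall x, positive (ip x x);
  ip_norm : forall x, bnorm x ^+ 2 = bnorm (ip x x) }.

(* A-B correspondences.  [lact_adj] says that [lact a] is adjointable with
   adjoint [lact (cadj a)]; in particular [lact a] is B-linear.  [lact_norm]
   (a *-homomorphism is contractive) is automatic.  Non-degeneracy is stated
   separately. *)
Record corr (A B : cstar R) := Corr {
  chilb :> hilbert B;
  lact : A -> chilb -> chilb;
  lactDl : forall a b x, lact (a + b) x = lact a x + lact b x;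
  lactZl : forall (c : C) a x, lact (c *: a) x = c *: lact a x;
  lactM : forall a b x, lact (cmul a b) x = lact a (lact b x);
  lact_adj : forall a x y, ip (lact a x) y = ip x (lact (cadj a) y);
  lact_norm : forall a x, bnorm (lact a x) <= bnorm a * bnorm x }.

Section Theory.
Variables (A : cstar R) (X : hilbert A).
Implicit Types x y z : X.

Lemma ipDl x y z : ip (x + y) z = ip x z + ip y z.
Proof. by rewrite -ipC ipDr cadjD !ipC. Qed.

Lemma ipZl (c : C) x y : ip (c *: x) y = conjc c *: ip x y.
Proof. by rewrite -ipC ipZr cadjZ ipC. Qed.

Lemma ipNr x y : ip x (- y) = - ip x y.
Proof. by rewrite -scaleN1r ipZr scaleN1r. Qed.

Lemma ipNl x y : ip (- x) y = - ip x y.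
Proof. by rewrite -ipC ipNr cadjN ipC. Qed.

Lemma ipBr x y z : ip x (y - z) = ip x y - ip x z.
Proof. by rewrite ipDr ipNr. Qed.

Lemma ipBl x y z : ip (x - y) z = ip x z - ip y z.
Proof. by rewrite ipDl ipNl. Qed.

Lemma ractBl x y a : ract (x - y) a = ract x a - ract y a.
Proof. by rewrite ractDl -scaleN1r ractZl scaleN1r. Qed.

Lemma ractBr x (a b : A) : ract x (a - b) = ract x a - ract x b.
Proof. by rewrite ractDr -scaleN1r ractZr scaleN1r. Qed.

Lemma hilbert_eq x y : (forall z, ip z x = ip z y) -> x = y.
Proof.
move=> h; apply/eqP; rewrite -subr_eq0; apply/eqP/bnorm0_eq0/eqP.
by rewrite -sqrf_eq0 ip_norm ipBr h subrr bnorm0.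
Qed.

Lemma ract_norm x a : bnorm (ract x a) <= bnorm x * bnorm a.
Proof.
rewrite -(@ler_pXn2r _ 2) ?nnegrE ?mulr_ge0 ?bnorm_ge0 // ip_norm ipMr -ipC ipMr.
rewrite cadjM ipC exprMn ip_norm.
apply: le_trans (cnormM _ _) _; rewrite expr2 mulrA ler_wpM2r ?bnorm_ge0 //.
by apply: le_trans (cnormM _ _) _; rewrite cadj_norm mulrC.
Qed.

(* The Cauchy-Schwarz inequality, without the optimal constant. *)
Lemma ip_bound x y : bnorm (ip x y) <= 6 * (bnorm x * bnorm y).
Proof.
have b1 (u v : X) : bnorm (ip u v + ip v u) <=
    2 * (bnorm u ^+ 2 + bnorm u * bnorm v + bnorm v ^+ 2).
  have -> : ip u v + ip v u = ip (u + v) (u + v) - ip u u - ip v v.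
    rewrite ipDl !ipDr addrA [_ - ip u u]addrAC addrK -[ip u u + _ + _]addrA.
    by rewrite addrAC subrr add0r.
  have := bnormD (ip (u + v) (u + v) - ip u u) (- ip v v).
  have := bnormD (ip (u + v) (u + v)) (- ip u u).
  rewrite !bnormN -!ip_norm => h1 h2.
  have : bnorm (u + v) ^+ 2 <= (bnorm u + bnorm v) ^+ 2.
    by rewrite ler_pXn2r ?nnegrE ?addr_ge0 ?bnorm_ge0 ?bnormD.
  by move: h1 h2; lra.
have ni : normc ('i%C : C) = 1.
  by rewrite /= expr0n expr1n /= add0r sqrtr1.
have ii : ('i%C : C) * 'i%C = -1.
  by apply/eqP; rewrite eq_complex /=; apply/andP; split; apply/eqP; ring.
have b2 (u v : X) : bnorm (ip u v) <=
    2 * (bnorm u ^+ 2 + bnorm u * bnorm v + bnorm v ^+ 2).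
  have e : ip u v + ip u v =
      (ip u v + ip v u) - 'i%C *: (ip u ('i%C *: v) + ip ('i%C *: v) u).
    rewrite ipZr ipZl scalerDr !scalerA ii.
    have -> : 'i%C * conjc ('i%C) = 1 :> C.
      by apply/eqP; rewrite eq_complex /=; apply/andP; split; apply/eqP; ring.
    by rewrite scale1r scaleN1r opprD opprK addrACA subrr addr0.
  have := bnormD (ip u v + ip v u) (- ('i%C *: (ip u ('i%C *: v) + ip ('i%C *: v) u))).
  rewrite -e bnormN bnormZ ni mul1r.
  have -> : ip u v + ip u v = (2 : R)%:C%C *: ip u v.
    by rewrite rmorph_nat scaler_nat mulr2n.
  rewrite bnormZ normc_real ger0_norm // => h.
  have k1 := b1 u v; have := b1 u ('i%C *: v); rewrite bnormZ ni mul1r => k2.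
  by move: h k1 k2; lra.
have [nx0|nx0] := eqVneq (bnorm x) 0.
  rewrite (bnorm0_eq0 nx0) -(scale0r (0 : X)) ipZl rmorph0 scale0r !bnorm0.
  by rewrite bnormZ ComplexField.Normc.normc0 !mul0r mulr0.
have [ny0|ny0] := eqVneq (bnorm y) 0.
  rewrite (bnorm0_eq0 ny0) -(scale0r (0 : X)) ipZr scale0r !bnorm0.
  by rewrite bnormZ ComplexField.Normc.normc0 !mul0r !mulr0.
have x0 : 0 < bnorm x by rewrite lt_def nx0 bnorm_ge0.
have y0 : 0 < bnorm y by rewrite lt_def ny0 bnorm_ge0.
have := b2 ((bnorm x)^-1%:C%C *: x) ((bnorm y)^-1%:C%C *: y).
rewrite ipZl ipZr conjc_real !bnormZ !normc_real !ger0_norm ?invr_ge0 ?bnorm_ge0 //.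
rewrite !mulVf // mulrA -invfM mulrC ler_pdivrMr ?mulr_gt0 //.
by rewrite expr1n mul1r; move=> h; apply: le_trans h _; rewrite le_eqVlt; apply/orP; left; apply/eqP; ring.
Qed.

End Theory.

Section PathModules.
Variables (A : cstar R) (X : hilbert A).
Local Notation IX := (path_banach X).
Local Notation IA := (path_cstar A).

Lemma path_ract_cont (f : IX) (a : IA) : path_continuous (fun t => ract (f t) (a t)).
Proof.
apply: (bilin_continuous (k := 1)) => [x x' y|x y y'|x y].
- exact: ractBl.
- exact: ractBr.
- by rewrite mul1r ract_norm.
Qed.

Lemma path_ip_cont (f g : IX) : path_continuous (fun t => ip (f t) (g t)).
Proof.
apply: (bilin_continuous (k := 6)) => [x x' y|x y y'|x y].
- exact: ipBl.
- exact: ipBr.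
- exact: ip_bound.
Qed.

Definition path_ract (f : IX) (a : IA) : IX := mk_cpath (path_ract_cont f a).
Definition path_ip (f g : IX) : IA := mk_cpath (path_ip_cont f g).

Program Definition path_hilbert : hilbert IA :=
  @Hilbert IA IX path_ract path_ip _ _ _ _ _ _ _ _ _ _ _.
Next Obligation. by move=> *; apply: (@cpath_ext _ X) => t; exact: ractDl. Qed.
Next Obligation. by move=> *; apply: (@cpath_ext _ X) => t; exact: ractDr. Qed.
Next Obligation. by move=> *; apply: (@cpath_ext _ X) => t; exact: ractZl. Qed.
Next Obligation. by move=> *; apply: (@cpath_ext _ X) => t; exact: ractZr. Qed.
Next Obligation. by move=> *; apply: (@cpath_ext _ X) => t; exact: ractM. Qed.
Next Obligation. by move=> *; apply: (@cpath_ext _ A) => t; exact: ipDr. Qed.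
Next Obligation. by move=> *; apply: (@cpath_ext _ A) => t; exact: ipZr. Qed.
Next Obligation. by move=> *; apply: (@cpath_ext _ A) => t; exact: ipMr. Qed.
Next Obligation. by move=> *; apply: (@cpath_ext _ A) => t; exact: ipC. Qed.
Next Obligation. by move=> f; apply: path_positive => t; exact: ip_pos. Qed.
Next Obligation.
move=> f; have [t e h] := cpath_norm_attained f.
apply/eqP; rewrite eq_le; apply/andP; split.
  rewrite -[bnorm f]/(cpath_norm f) e ip_norm.
  exact: (cpath_norm_ge (path_ip f f) t).
apply: cpath_norm_le => s; rewrite -ip_norm.
rewrite ler_pXn2r ?nnegrE ?bnorm_ge0 ?cpath_norm_ge //.
Qed.

End PathModules.

Section PathCorr.
Variables (A B : cstar R) (X : corr A B).
Local Notation IX := (path_hilbert X).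
Local Notation IA := (path_cstar A).
Local Notation IB := (path_cstar B).

Lemma lactBl (a b : A) (x : X) : lact (a - b) x = lact a x - lact b x.
Proof. by rewrite lactDl -scaleN1r lactZl scaleN1r. Qed.

Lemma lactBr (a : A) (x y : X) : lact a (x - y) = lact a x - lact a y.
Proof.
apply: hilbert_eq => z.
by rewrite -[in LHS](cadjK a) -lact_adj !ipBr !lact_adj !cadjK.
Qed.

Lemma path_lact_cont (a : IA) (f : IX) : path_continuous (fun t => lact (a t) (f t)).
Proof.
apply: (bilin_continuous (k := 1)) => [x x' y|x y y'|x y].
- exact: lactBl.
- exact: lactBr.
- by rewrite mul1r lact_norm.
Qed.

Definition path_lact (a : IA) (f : IX) : IX := mk_cpath (path_lact_cont a f).

Program Definition path_corr : corr IA IB :=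
  @Corr IA IB IX path_lact _ _ _ _ _.
Next Obligation. by move=> *; apply: (@cpath_ext _ X) => t; exact: lactDl. Qed.
Next Obligation. by move=> *; apply: (@cpath_ext _ X) => t; exact: lactZl. Qed.
Next Obligation. by move=> *; apply: (@cpath_ext _ X) => t; exact: lactM. Qed.
Next Obligation. by move=> *; apply: (@cpath_ext _ B) => t; exact: lact_adj. Qed.
Next Obligation.
move=> a f; apply: cpath_norm_le => t; apply: le_trans (lact_norm _ _) _.
by apply: ler_pM; rewrite ?bnorm_ge0 ?cpath_norm_ge.
Qed.

End PathCorr.

Section Evaluation.
Variable A : cstar R.

Program Definition self_hilbert : hilbert A :=
  @Hilbert A A (@cmul R A) (fun a b => cmul (cadj a) b) _ _ _ _ _ _ _ _ _ _ _.
Next Obligation. exact: cmulDl. Qed.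
Next Obligation. exact: cmulDr. Qed.
Next Obligation. exact: cmulZl. Qed.
Next Obligation. exact: cmulZr. Qed.
Next Obligation. exact: cmulA. Qed.
Next Obligation. by move=> *; exact: cmulDr. Qed.
Next Obligation. by move=> *; exact: cmulZr. Qed.
Next Obligation. by move=> *; exact: cmulA. Qed.
Next Obligation. by move=> *; rewrite /= cadjM cadjK. Qed.
Next Obligation. by move=> *; exact: cadj_mul_pos. Qed.
Next Obligation. by move=> *; rewrite /= cnorm_star. Qed.

Program Definition eval_corr (t : unitI R) : corr (path_cstar A) A :=
  @Corr (path_cstar A) A self_hilbert (fun f a => cmul (f t) a) _ _ _ _ _.
Next Obligation. by move=> *; exact: cmulDl. Qed.
Next Obligation. by move=> *; exact: cmulZl. Qed.
Next Obligation. by move=> *; rewrite /= cmulA. Qed.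
Next Obligation. by move=> *; rewrite /= cadjM cmulA. Qed.
Next Obligation.
move=> t f a; apply: le_trans (cnormM _ _) _.
by rewrite ler_wpM2r ?bnorm_ge0 // cpath_norm_ge.
Qed.

End Evaluation.

Section ZeroCorr.
Variables A B : cstar R.

Lemma positive0 : positive (0 : B).
Proof. by have := cadj_mul_pos (0 : B); rewrite cmulr0. Qed.

Lemma ffun_void_eq (f g : {ffun void -> C}) : f = g.
Proof. by apply/ffunP; case. Qed.

Program Definition zero_hilbert : hilbert B :=
  @Hilbert B (fun_banach R void) (fun x _ => x) (fun _ _ => 0) _ _ _ _ _ _ _ _ _ _ _.
Next Obligation. by []. Qed.
Next Obligation. by move=> *; exact: ffun_void_eq. Qed.
Next Obligation. by []. Qed.
Next Obligation. by move=> *; exact: ffun_void_eq. Qed.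
Next Obligation. by []. Qed.
Next Obligation. by move=> *; rewrite /= addr0. Qed.
Next Obligation. by move=> *; rewrite /= scaler0. Qed.
Next Obligation. by move=> *; rewrite /= cmul0r. Qed.
Next Obligation. by move=> *; rewrite /= -(scale0r (0 : B)) cadjZ rmorph0 !scale0r. Qed.
Next Obligation. by move=> *; exact: positive0. Qed.
Next Obligation.
by move=> x; rewrite (ffun_void_eq x 0) !bnorm0 expr0n.
Qed.

Program Definition zero_corr : corr A B :=
  @Corr A B zero_hilbert (fun _ x => x) _ _ _ _ _.
Next Obligation. by move=> *; exact: ffun_void_eq. Qed.
Next Obligation. by move=> *; exact: ffun_void_eq. Qed.
Next Obligation. by []. Qed.
Next Obligation. by []. Qed.
Next Obligation.
by move=> a x; rewrite (ffun_void_eq x 0) bnorm0 mulr0.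
Qed.

End ZeroCorr.
End HilbertModules.

Section GraphCorr.
Context (R : realType).
Local Notation C := R[i].

Section EdgeFunctions.
Variables (V W E : finType) (s : E -> V) (r : E -> W).
Implicit Types x y : {ffun E -> C}.

Definition edge_ract x (b : {ffun W -> C}) : {ffun E -> C} := [ffun e => x e * b (r e)].
Definition edge_lact (a : {ffun V -> C}) x : {ffun E -> C} := [ffun e => a (s e) * x e].
Definition edge_ip x y : {ffun W -> C} :=
  [ffun w => \sum_(e | r e == w) conjc (x e) * y e].
Definition edge_norm x : R := Num.sqrt (fun_norm (edge_ip x x)).

Lemma edge_ipE x w :
  edge_ip x x w = (\sum_(e | r e == w) normc (x e) ^+ 2)%:C%C.
Proof.
by rewrite ffunE rmorph_sum; apply: eq_bigr => e _; exact: conjc_mul.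
Qed.

Lemma normc_edge_ip x w :
  normc (edge_ip x x w) = \sum_(e | r e == w) normc (x e) ^+ 2.
Proof.
by rewrite edge_ipE normc_real ger0_norm // sumr_ge0 // => e _; exact: sqr_ge0.
Qed.

Lemma edge_norm_ge0 x : 0 <= edge_norm x.
Proof. exact: sqrtr_ge0. Qed.

Lemma edge_normE x : edge_norm x ^+ 2 = fun_norm (edge_ip x x).
Proof. by rewrite sqr_sqrtr // fun_norm_ge0. Qed.

Lemma edge_norm_le x M : 0 <= M ->
  (forall w, \sum_(e | r e == w) normc (x e) ^+ 2 <= M ^+ 2) -> edge_norm x <= M.
Proof.
move=> M0 h; rewrite -(@ler_pXn2r _ 2) ?nnegrE ?edge_norm_ge0 // edge_normE.
by apply: fun_norm_le => [|w]; rewrite ?exprn_ge0 // normc_edge_ip.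
Qed.

Lemma edge_norm_ge x w : \sum_(e | r e == w) normc (x e) ^+ 2 <= edge_norm x ^+ 2.
Proof. by rewrite edge_normE -normc_edge_ip fun_norm_ge. Qed.

Lemma edge_norm_coord x e : normc (x e) <= edge_norm x.
Proof.
rewrite -(@ler_pXn2r _ 2) ?nnegrE ?edge_norm_ge0 ?normc_ge0 //.
apply: le_trans (edge_norm_ge x (r e)); rewrite (bigD1 e) //= lerDl.
by apply: sumr_ge0 => f _; exact: sqr_ge0.
Qed.

Lemma edge_norm0_eq0 x : edge_norm x = 0 -> x = 0.
Proof.
move=> x0; apply/ffunP => e; rewrite ffunE; apply: ComplexField.Normc.eq0_normc.
by apply/eqP; rewrite eq_le normc_ge0 andbT -x0 edge_norm_coord.
Qed.

Lemma edge_normD x y : edge_norm (x + y) <= edge_norm x + edge_norm y.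
Proof.
apply: edge_norm_le => [|w]; first by rewrite addr_ge0 ?edge_norm_ge0.
apply: le_trans (sqrt_sum_tri (fun e => normc_ge0 (x e)) (fun e => normc_ge0 (y e))
  (edge_norm_ge0 x) (edge_norm_ge0 y) (edge_norm_ge x w) (edge_norm_ge y w)).
apply: ler_sum => e _; rewrite ffunE ler_pXn2r ?nnegrE ?normc_ge0 ?le_normcD //.
by rewrite addr_ge0 ?normc_ge0.
Qed.

Lemma edge_normZ c x : edge_norm (c *: x) = normc c * edge_norm x.
Proof.
have -> : edge_norm (c *: x) = Num.sqrt (fun_norm ((normc c ^+ 2)%:C%C *: edge_ip x x)).
  congr (Num.sqrt (fun_norm _)); apply/ffunP => w; rewrite !ffunE.
  rewrite -[RHS]/(_ * _) mulr_sumr; apply: eq_bigr => e _; rewrite !ffunE.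
  rewrite -[c *: x e]/(c * x e) rmorphM mulrACA.
  by congr (_ * _); exact: conjc_mul.
rewrite fun_normZ normc_real ger0_norm ?sqr_ge0 // sqrtrM ?sqr_ge0 //.
by rewrite sqrtr_sqr ger0_norm ?normc_ge0.
Qed.

Lemma edge_complete (u : nat -> {ffun E -> C}) :
  seq_cauchy edge_norm u -> exists l, seq_cvg edge_norm u l.
Proof.
apply: ffun_complete => [f e|f]; first exact: edge_norm_coord.
apply: edge_norm_le => [|w]; first by apply: sumr_ge0 => e _; exact: normc_ge0.
apply: le_trans (_ : \sum_e normc (f e) ^+ 2 <= _).
  by rewrite [leRHS](bigID (fun e => r e == w)) /= lerDl sumr_ge0 // => e _; exact: sqr_ge0.
rewrite [leRHS]expr2 mulr_suml; apply: ler_sum => e _.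
rewrite expr2 ler_wpM2l ?normc_ge0 // (bigD1 e) //= lerDl.
by apply: sumr_ge0 => g _; exact: normc_ge0.
Qed.

Definition edge_banach : banach R :=
  Banach edge_norm0_eq0 edge_normD edge_normZ edge_complete.

Program Definition edge_hilbert : hilbert (fun_cstar R W) :=
  @Hilbert R (fun_cstar R W) edge_banach edge_ract edge_ip _ _ _ _ _ _ _ _ _ _ _.
Next Obligation. by move=> *; apply/ffunP => e; rewrite !ffunE mulrDl. Qed.
Next Obligation. by move=> *; apply/ffunP => e; rewrite !ffunE mulrDr. Qed.
Next Obligation. by move=> *; apply/ffunP => e; rewrite !ffunE; exact: (esym (mulrA _ _ _)). Qed.
Next Obligation. by move=> *; apply/ffunP => e; rewrite !ffunE; exact: mulrCA. Qed.
Next Obligation. by move=> *; apply/ffunP => e; rewrite !ffunE mulrA. Qed.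
Next Obligation.
move=> *; apply/ffunP => w; rewrite !ffunE -big_split; apply: eq_bigr => e _.
by rewrite !ffunE mulrDr.
Qed.
Next Obligation.
move=> *; apply/ffunP => w; rewrite !ffunE -[RHS]/(_ * _) mulr_sumr.
by apply: eq_bigr => e _; rewrite !ffunE; exact: mulrCA.
Qed.
Next Obligation.
move=> *; apply/ffunP => w; rewrite !ffunE mulr_suml.
by apply: eq_bigr => e /eqP <-; rewrite !ffunE mulrA.
Qed.
Next Obligation.
move=> *; apply/ffunP => w; rewrite !ffunE rmorph_sum.
by apply: eq_bigr => e _; rewrite rmorphM /= conjcK mulrC.
Qed.
Next Obligation.
move=> x; apply: fun_positive => w; rewrite edge_ipE ler0c.
by apply: sumr_ge0 => e _; exact: sqr_ge0.
Qed.
Next Obligation. exact: edge_normE. Qed.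

Program Definition edge_corr : corr (fun_cstar R V) (fun_cstar R W) :=
  @Corr R (fun_cstar R V) (fun_cstar R W) edge_hilbert edge_lact _ _ _ _ _.
Next Obligation. by move=> *; apply/ffunP => e; rewrite !ffunE mulrDl. Qed.
Next Obligation. by move=> *; apply/ffunP => e; rewrite !ffunE; exact: (esym (mulrA _ _ _)). Qed.
Next Obligation. by move=> *; apply/ffunP => e; rewrite !ffunE mulrA. Qed.
Next Obligation.
move=> *; apply/ffunP => w; rewrite !ffunE; apply: eq_bigr => e _.
by rewrite !ffunE rmorphM mulrA [conjc _ * conjc _]mulrC.
Qed.
Next Obligation.
move=> a x; apply: edge_norm_le => [|w]; first by rewrite mulr_ge0 ?bnorm_ge0.
apply: le_trans (_ : \sum_(e | r e == w) bnorm a ^+ 2 * normc (x e) ^+ 2 <= _).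
  apply: ler_sum => e _; rewrite ffunE ComplexField.Normc.normcM exprMn ler_wpM2r ?sqr_ge0 //.
  by rewrite ler_pXn2r ?nnegrE ?normc_ge0 ?bnorm_ge0 ?fun_norm_ge.
by rewrite -mulr_sumr exprMn ler_wpM2l ?sqr_ge0 // edge_norm_ge.
Qed.

End EdgeFunctions.

Definition edge (n p : nat) (A : 'M[nat]_(n, p)) :=
  {vw : 'I_n * 'I_p & 'I_(A vw.1 vw.2)}.

Definition graph_corr (n p : nat) (A : 'M[nat]_(n, p)) :
    corr (fun_cstar R 'I_n) (fun_cstar R 'I_p) :=
  edge_corr (fun e : edge A => (tag e).1) (fun e : edge A => (tag e).2).

End GraphCorr.

Section Correspondences.
Context (R : realType).

Definition corr_full (A B : cstar R) (X : corr A B) : Prop :=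
  forall (b : B) (e : R), 0 < e -> exists s : seq (X * X),
    bnorm (b - \sum_(p <- s) ip p.1 p.2) < e.

(* [lact a] is an operator-norm limit of finite sums of rank-one operators
   [z |-> x <y, z>]. *)
Definition corr_proper (A B : cstar R) (X : corr A B) : Prop :=
  forall (a : A) (e : R), 0 < e -> exists s : seq (X * X), forall z : X,
    bnorm (lact a z - \sum_(p <- s) ract p.1 (ip p.2 z)) <= e * bnorm z.

Definition corr_nondegenerate (A B : cstar R) (X : corr A B) : Prop :=
  forall x : X, exists (a : A) (y : X), x = lact a y.

Definition corr_injective (A B : cstar R) (X : corr A B) : Prop :=
  forall a : A, (forall x : X, lact a x = 0) -> a = 0.

Definition corr_regular (A B : cstar R) (X : corr A B) : Prop :=
  corr_injective X /\ corr_proper X.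

Record unitary (A B : cstar R) (X Y : corr A B) (U : X -> Y) : Prop := Unitary {
  unitaryD : forall x y, U (x + y) = U x + U y;
  unitaryZ : forall (c : R[i]) x, U (c *: x) = c *: U x;
  unitary_ract : forall x b, U (ract x b) = ract (U x) b;
  unitary_lact : forall a x, U (lact a x) = lact a (U x);
  unitary_ip : forall x y, ip (U x) (U y) = ip x y;
  unitary_surj : forall y, exists x, U x = y }.

(* [T] with [t : X -> Y -> T] is an interior tensor product of [X] and [Y]: the
   completion of the balanced algebraic tensor product for
   <x (x) y, x' (x) y'> = <y, <x, x'> y'>. *)
Record is_tensor (A B D : cstar R) (X : corr A B) (Y : corr B D)
    (T : corr A D) (t : X -> Y -> T) : Prop := IsTensor {
  tensorDl : forall x x' y, t (x + x') y = t x y + t x' y;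
  tensorDr : forall x y y', t x (y + y') = t x y + t x y';
  tensorZl : forall (c : R[i]) x y, t (c *: x) y = c *: t x y;
  tensorZr : forall (c : R[i]) x y, t x (c *: y) = c *: t x y;
  tensor_balanced : forall x b y, t (ract x b) y = t x (lact b y);
  tensor_lact : forall a x y, t (lact a x) y = lact a (t x y);
  tensor_ract : forall x y d, t x (ract y d) = ract (t x y) d;
  tensor_ip : forall x y x' y',
    ip (t x y) (t x' y') = ip y (lact (ip x x') y');
  tensor_dense : forall (z : T) (e : R), 0 < e -> exists s : seq (X * Y),
    bnorm (z - \sum_(p <- s) t p.1 p.2) < e }.

(* Interior tensor products exist and are unique up to a unique unitary
   commuting with the maps [t]; one is chosen.  The default value is never used. *)
Definition tensor_choice (A B D : cstar R) (X : corr A B) (Y : corr B D) :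
    {T : corr A D & X -> Y -> T} :=
  if pselect (exists p : {T : corr A D & X -> Y -> T}, is_tensor (projT2 p))
  is left h then projT1 (cid h)
  else existT (fun T : corr A D => X -> Y -> T) (zero_corr A D) (fun _ _ => 0).

Definition tens (A B D : cstar R) (X : corr A B) (Y : corr B D) : corr A D :=
  projT1 (tensor_choice X Y).

(* [elt x y] is x (x) y. *)
Definition elt (A B D : cstar R) (X : corr A B) (Y : corr B D) :
    X -> Y -> tens X Y :=
  projT2 (tensor_choice X Y).

(* The unitary satisfying [P].  In each use below [P] prescribes the values on a
   total set of vectors, so that there is exactly one such unitary. *)
Definition the_unitary (A B : cstar R) (X Y : corr A B) (P : (X -> Y) -> Prop) :
    X -> Y :=
  if pselect (exists U : X -> Y, unitary U /\ P U) is left h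
  then projT1 (cid h) else fun=> 0.

Definition tensl (A B D : cstar R) (X X' : corr A B) (Y : corr B D)
    (U : X -> X') : tens X Y -> tens X' Y :=
  the_unitary (fun T => forall x y, T (elt x y) = elt (U x) y).

Definition tensr (A B D : cstar R) (X : corr A B) (Y Y' : corr B D)
    (U : Y -> Y') : tens X Y -> tens X Y' :=
  the_unitary (fun T => forall x y, T (elt x y) = elt x (U y)).

Definition tens_assoc (A B D E : cstar R) (X : corr A B) (Y : corr B D) (Z : corr D E) :
    tens (tens X Y) Z -> tens X (tens Y Z) :=
  the_unitary (fun T => forall x y z, T (elt (elt x y) z) = elt x (elt y z)).

Definition tens_assocV (A B D E : cstar R) (X : corr A B) (Y : corr B D) (Z : corr D E) :
    tens X (tens Y Z) -> tens (tens X Y) Z :=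
  the_unitary (fun T => forall x y z, T (elt x (elt y z)) = elt (elt x y) z).

End Correspondences.

Section Bicategory.
Context (R : realType).

Record obj := Obj { oalg : cstar R; ocorr :> corr oalg oalg }.

Definition is_obj (X : obj) : Prop :=
  corr_nondegenerate X /\ corr_full X /\ corr_regular X.

(* [arrow Y X] consists of the data of the 1-arrows from [X] to [Y], written
   (B, Y) <- (A, X). *)
Record arrow (Y X : obj) := Arrow {
  acorr :> corr (oalg Y) (oalg X);
  amap : tens Y acorr -> tens acorr X }.

Definition is_arrow (Y X : obj) (F : arrow Y X) : Prop :=
  corr_nondegenerate F /\ corr_full F /\ corr_proper F /\ unitary (@amap Y X F).

Definition is_2arrow (Y X : obj) (F G : arrow Y X) (psi : F -> G) : Prop :=
  unitary psi /\
  forall z : tens Y F, tensl psi (amap z) = amap (tensr psi z).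

Definition arrow_comp_map (Z Y X : obj) (G : arrow Z Y) (F : arrow Y X) :
    tens Z (tens G F) -> tens (tens G F) X :=
  fun u => tens_assocV (tensr (@amap _ _ F) (tens_assoc (tensl (@amap _ _ G) (tens_assocV u)))).

Definition arrow_comp (Z Y X : obj) (G : arrow Z Y) (F : arrow Y X) : arrow Z X :=
  Arrow (@arrow_comp_map Z Y X G F).

(* [tpow X n] is the (n+1)-st tensor power of [X]. *)
Fixpoint tpow (X : obj) (n : nat) : corr (oalg X) (oalg X) :=
  if n is n'.+1 then tens (tpow X n') X else X.

(* The associativity identification *)
Fixpoint tpow_map (X : obj) (n : nat) : tens X (tpow X n) -> tens (tpow X n) X :=
  match n with
  | 0 => id
  | n'.+1 => fun u => tensl (@tpow_map X n') (tens_assocV u)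
  end.

(* Only meaningful for m >= 1, where the power is [tpow X m.-1]. *)
Definition pow_arrow (X : obj) (m : nat) : arrow X X :=
  Arrow (@tpow_map X m.-1).

Definition path_obj (X : obj) : obj := Obj (path_corr X).

(* Both sides are identified with [X] by f (x) a |-> f(t) a and b (x) x |-> b x. *)
Definition eval_map (X : obj) (t : unitI R) :
    tens (path_corr X) (eval_corr (oalg X) t) -> tens (eval_corr (oalg X) t) X :=
  the_unitary (fun T => forall (f : cpath X) (a b : oalg X) (x : X),
    ract (f t) a = lact b x ->
    T (@elt R _ _ _ (path_corr X) (eval_corr (oalg X) t) f a) =
    @elt R _ _ _ (eval_corr (oalg X) t) X b x).

Definition eval_arrow (X : obj) (t : unitI R) : arrow (path_obj X) X :=
  @Arrow (path_obj X) X (eval_corr (oalg X) t) (@eval_map X t).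

(* [path_obj X] is an object when [X] is, and composites with [eval_arrow X t] of
   1-arrows are 1-arrows, so neither is imposed. *)
Definition homotopic (Y X : obj) (F G : arrow Y X) : Prop :=
  exists H : arrow Y (path_obj X), is_arrow H /\
    (exists h0, is_2arrow (F := arrow_comp H (eval_arrow X (clamp 0))) (G := F) h0) /\
    (exists h1, is_2arrow (F := arrow_comp H (eval_arrow X (clamp 1))) (G := G) h1).

Definition homotopy_shift_equivalent (m : nat) (X Y : obj) : Prop :=
  [/\ (0 < m)%N, is_obj X, is_obj Y &
    exists (M : arrow X Y) (N : arrow Y X), [/\ is_arrow M, is_arrow N,
      homotopic (arrow_comp M N) (pow_arrow X m) &
      homotopic (arrow_comp N M) (pow_arrow Y m)]].

Definition graph_obj (n : nat) (A : 'M[nat]_n) : obj := Obj (graph_corr R A).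

End Bicategory.

Definition essential (n : nat) (A : 'M[nat]_n) : Prop :=
  (forall i, row i A != 0) /\ (forall j, col j A != 0).

Definition shift_equivalent (m n p : nat) (A : 'M[nat]_n) (B : 'M[nat]_p) : Prop :=
  (0 < m)%N /\ exists (R : 'M[nat]_(n, p)) (S : 'M[nat]_(p, n)),
    [/\ A ^+ m = R *m S, B ^+ m = S *m R, B *m S = S *m A & A *m R = R *m B].

(* Main.v *)
(* For finite graphs, the tensor product X(E) (x) X(F) is X(EF), where EF is the
   graph of composable pairs of edges.  The equalities AR = RB and BS = SA give
   bijections between paths, hence Phi_M and Phi_N for M = X(R) and N = X(S), and
   A^m = RS identifies M (x) N with X(A)^m, which carries two 1-arrow structures.
   After identification both are unitaries between X(A) (x) X(A)^m and
   X(A)^m (x) X(A) which permute edges and hence differ by a permutation of parallel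
   edges.  Such a permutation is a product of involutive unitaries t, each joined
   to 1 by (1+c)/2 + (1-c)/2 t, where c runs through the half circle from 1 to -1.
   The resulting path of unitaries is a 1-arrow structure on C(I, X(A)^m), and this
   is the homotopy. *)

From HB Require Import structures.
Require Import Defs.
From mathcomp Require Import all_boot all_order fingroup perm all_algebra.
From mathcomp Require Import complex.
From mathcomp Require Import all_classical all_reals all_analysis.
From mathcomp Require Import ring lra.

Set Implicit Arguments.
Unset Strict Implicit.
Unset Printing Implicit Defensive.
Import Order.TTheory GRing.Theory Num.Theory.
Import numFieldNormedType.Exports.
Local Open Scope ring_scope.

(** * Unitaries between correspondences *)

Section Unitaries.
Context (R : realType).

(** The bijections behind Phi_M and Phi_N come from equality of cardinalities alone, so nothing
    makes their composite agree with the associativity identification; this is why a homotopy is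
    needed. The technical obstacle is that [tens] is an arbitrary choice among completions, and that
    [tensl], [tensr] and [tens_assoc] have a meaning only once a unitary with the prescribed values
    is known to exist. Hence an explicit model is supplied for each tensor product that occurs. The
    modules in play have finite frames over c(V) or C(I, c(V)), so elementary tensors span them
    without closure, and unitaries are built and compared through Gram matrices of spanning
    families. The homotopy module is C(I, X(A)^m) with c(V) acting by constant functions; its tensor
    products with X(A), with C(I, X(A)) and with evaluations are again modules of paths or their
    fibres. *)

Lemma ip_suml (A : cstar R) (X : hilbert A) (I : Type) (s : seq I) (f : I -> X) y :
  ip (\sum_(i <- s) f i) y = \sum_(i <- s) ip (f i) y.
Proof.
elim: s => [|i s IH]; last by rewrite !big_cons ipDl IH.
by rewrite !big_nil -(scale0r (0 : X)) ipZl rmorph0 scale0r.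
Qed.

Lemma ip_sumr (A : cstar R) (X : hilbert A) (I : Type) (s : seq I) x (f : I -> X) :
  ip x (\sum_(i <- s) f i) = \sum_(i <- s) ip x (f i).
Proof.
elim: s => [|i s IH]; last by rewrite !big_cons ipDr IH.
by rewrite !big_nil -(scale0r (0 : X)) ipZr scale0r.
Qed.

Lemma ract_suml (A : cstar R) (X : hilbert A) (I : Type) (s : seq I) (f : I -> X) a :
  ract (\sum_(i <- s) f i) a = \sum_(i <- s) ract (f i) a.
Proof.
elim: s => [|i s IH]; last by rewrite !big_cons ractDl IH.
by rewrite !big_nil -(scale0r (0 : X)) ractZl !scale0r.
Qed.

Section Lact.
Variables (A B : cstar R) (X : corr A B).

Lemma lactDr (a : A) (x y : X) : lact a (x + y) = lact a x + lact a y.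
Proof. by apply: (addIr (- lact a y)); rewrite addrK -lactBr addrK. Qed.

Lemma lactZr (a : A) c (x : X) : lact a (c *: x) = c *: lact a x.
Proof.
apply: hilbert_eq => z.
by rewrite -[in LHS](cadjK a) -lact_adj !ipZr !lact_adj !cadjK.
Qed.

Lemma lact_sumr (I : Type) (s : seq I) (f : I -> X) (a : A) :
  lact a (\sum_(i <- s) f i) = \sum_(i <- s) lact a (f i).
Proof.
elim: s => [|i s IH]; last by rewrite !big_cons lactDr IH.
by rewrite !big_nil -(scale0r (0 : X)) lactZr !scale0r.
Qed.

Lemma lact_ract (a : A) (x : X) b : lact a (ract x b) = ract (lact a x) b.
Proof.
apply: hilbert_eq => z.
by rewrite -[in LHS](cadjK a) -lact_adj !ipMr lact_adj cadjK.
Qed.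

End Lact.

Lemma bnorm_ip (A : cstar R) (X Y : hilbert A) (x : X) (y : Y) :
  ip x x = ip y y -> bnorm x = bnorm y.
Proof.
by move=> h; apply/eqP; rewrite -(@eqrXn2 _ 2) ?bnorm_ge0 // !ip_norm h.
Qed.

Section UnitaryTheory.
Variables (A B : cstar R).
Implicit Types X Y Z : corr A B.

(** Linearity comes for free: the values of a surjective [U] separate points by inner products, and
    against these values [U] is linear. The left action is tested by inner products too, the form in
    which it is known on tensors. *)
Lemma unitary_of_ip X Y (U : X -> Y) :
  (forall x y, ip (U x) (U y) = ip x y) -> (forall y, exists x, U x = y) ->
  (forall a x y, ip (U y) (lact a (U x)) = ip y (lact a x)) -> unitary U.
Proof.
move=> Uip Us Ul.
have ext u v : (forall y, ip (U y) u = ip (U y) v) -> u = v.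
  by move=> h; apply: hilbert_eq => z; have [y <-] := Us z.
split=> //.
- by move=> x y; apply: ext => z; rewrite ipDr !Uip ipDr.
- by move=> c x; apply: ext => z; rewrite ipZr !Uip ipZr.
- by move=> x b; apply: ext => z; rewrite ipMr !Uip ipMr.
- by move=> a x; apply: ext => z; rewrite Ul Uip.
Qed.

Lemma unitary_norm X Y (U : X -> Y) : unitary U -> forall x, bnorm (U x) = bnorm x.
Proof. by move=> hU x; apply: bnorm_ip; rewrite unitary_ip. Qed.

Lemma unitaryB X Y (U : X -> Y) : unitary U -> forall x y, U (x - y) = U x - U y.
Proof.
by move=> hU x y; rewrite (unitaryD hU) -scaleN1r (unitaryZ hU) scaleN1r.
Qed.

Lemma unitary_inj X Y (U : X -> Y) : unitary U -> injective U.
Proof.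
move=> hU x y h; apply/eqP; rewrite -subr_eq0; apply/eqP/bnorm0_eq0.
by rewrite -(unitary_norm hU) (unitaryB hU) h subrr bnorm0.
Qed.

Lemma unitary_sum X Y (U : X -> Y) : unitary U ->
  forall (I : Type) (s : seq I) (f : I -> X),
  U (\sum_(i <- s) f i) = \sum_(i <- s) U (f i).
Proof.
move=> hU I s f; elim: s => [|i s IH]; last by rewrite !big_cons (unitaryD hU) IH.
by rewrite !big_nil -(scale0r (0 : X)) (unitaryZ hU) !scale0r.
Qed.

Lemma unitary_id X : unitary (@id X).
Proof. by apply: unitary_of_ip => // y; exists y. Qed.

Lemma unitary_comp X Y Z (U : X -> Y) (W : Y -> Z) :
  unitary U -> unitary W -> unitary (W \o U).
Proof.
move=> hU hW; apply: unitary_of_ip => [x y|z|a x y] /=.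
- by rewrite (unitary_ip hW) (unitary_ip hU).
- by have [y <-] := unitary_surj hW z; have [x <-] := unitary_surj hU y; exists x.
- by rewrite -(unitary_lact hW) -(unitary_lact hU) (unitary_ip hW) (unitary_ip hU).
Qed.

Lemma unitary_inv X Y (U : X -> Y) : unitary U ->
  exists V : Y -> X, [/\ unitary V, cancel U V & cancel V U].
Proof.
move=> hU; have /choice [V hV] := unitary_surj hU.
have UV : cancel U V by move=> x; apply: (unitary_inj hU); rewrite hV.
exists V; split=> //; apply: unitary_of_ip => [x y|x|a x y].
- by rewrite -(unitary_ip hU) !hV.
- by exists (U x).
- by rewrite -(unitary_ip hU) (unitary_lact hU) !hV.
Qed.

(** Sums without coefficients and without closure: scalars have to be absorbed in the index, as in
    [span_delta]. *)
Definition span X (I : Type) (t : I -> X) :=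
  forall z, exists s : seq I, z = \sum_(i <- s) t i.

Lemma span_unitary_eq X Y (I : Type) (t : I -> X) (U W : X -> Y) :
  span t -> unitary U -> unitary W -> (forall i, U (t i) = W (t i)) -> U =1 W.
Proof.
move=> ht hU hW h z; have [s ->] := ht z.
by rewrite (unitary_sum hU) (unitary_sum hW); apply: eq_bigr.
Qed.

Lemma span_sub X (I J : Type) (t : I -> X) (u : J -> X) :
  span t -> (forall i, exists s : seq J, t i = \sum_(j <- s) u j) -> span u.
Proof.
move=> ht /choice [f hf] z; have [s ->] := ht z.
exists (flatten (map f s)); rewrite big_flatten /= big_map.
by apply: eq_bigr.
Qed.

(** Equal Gram matrices give a difference of two sums the same norm on both sides, so the value does
    not depend on the representation chosen by [f]. The family [u] may fail to span, which admits
    targets where elementary tensors are only known to be total. *)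
Lemma isometric_extension X Y (I : Type) (t : I -> X) (u : I -> Y) :
  span t -> (forall i j, ip (u i) (u j) = ip (t i) (t j)) ->
  exists U : X -> Y, [/\ forall x y, ip (U x) (U y) = ip x y,
    forall i, U (t i) = u i &
    forall z, exists2 s : seq I, z = \sum_(i <- s) t i & U z = \sum_(i <- s) u i].
Proof.
move=> ht h; have /choice [f hf] := ht.
pose U z := \sum_(i <- f z) u i.
have hU (s1 s2 : seq I) : ip (\sum_(i <- s1) u i) (\sum_(i <- s2) u i) =
    ip (\sum_(i <- s1) t i) (\sum_(i <- s2) t i).
  rewrite !ip_suml; apply: eq_bigr => i _; rewrite !ip_sumr.
  by apply: eq_bigr => j _.
exists U; split=> [x y|i|z]; [by rewrite hU -!hf| |by exists (f z)].
apply/eqP; rewrite -subr_eq0; apply/eqP/bnorm0_eq0.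
have e1 s1 s2 : \sum_(i <- s1) t i = \sum_(i <- s2) t i ->
    \sum_(i <- s1) u i = \sum_(i <- s2) u i.
  move=> e; apply/eqP; rewrite -subr_eq0; apply/eqP/bnorm0_eq0/eqP.
  rewrite -sqrf_eq0 ip_norm ipBl !ipBr !hU e !subrr bnorm0 //.
by rewrite /U (e1 _ [:: i]) ?big_seq1 ?subrr ?bnorm0 // -hf.
Qed.

(** The Gram matrix weighted by [a] carries the left action; the plain one is not an instance of it,
    because [A] may have no unit. *)
Lemma unitary_extension X Y (I : Type) (t : I -> X) (u : I -> Y) :
  span t -> span u -> (forall i j, ip (u i) (u j) = ip (t i) (t j)) ->
  (forall a i j, ip (u i) (lact a (u j)) = ip (t i) (lact a (t j))) ->
  exists U : X -> Y, unitary U /\ forall i, U (t i) = u i.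
Proof.
move=> ht hu h hl.
have [U [Uip Ut Us]] := isometric_extension ht h.
exists U; split=> //; apply: unitary_of_ip => [//|y|a x y].
  have [s ->] := hu y.
  exists (\sum_(i <- s) t i); apply: hilbert_eq => z; have [s' ->] := hu z.
  rewrite !ip_suml; apply: eq_bigr => i _; rewrite ip_sumr -Ut Uip ip_sumr.
  by apply: eq_bigr => j _; rewrite -Uip !Ut.
have [s1 -> ->] := Us x; have [s2 -> ->] := Us y.
rewrite !ip_suml; apply: eq_bigr => i _; rewrite !lact_sumr !ip_sumr.
by apply: eq_bigr => j _.
Qed.

(** The defect of additivity is a combination of values of [U] and is orthogonal to all values of
    [U], hence to itself. *)
Lemma isometryB X Y (U : X -> Y) :
  (forall x y, ip (U x) (U y) = ip x y) -> forall x y, U (x - y) = U x - U y.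
Proof.
move=> Uip x y; apply/eqP; rewrite -subr_eq0; apply/eqP/bnorm0_eq0/eqP.
rewrite -sqrf_eq0 ip_norm; set d := U (x - y) - _.
have d0 z : ip d (U z) = 0 by rewrite /d !ipBl !Uip ipBl subrr.
by rewrite {2}/d !ipBr !d0 !subr0 bnorm0.
Qed.

(* An isometry defined on a complete space has closed range. *)
Lemma isometry_surj X Y (U : X -> Y) :
  (forall x y, ip (U x) (U y) = ip x y) ->
  (forall z e, 0 < e -> exists x, bnorm (z - U x) < e) ->
  forall z, exists x, U x = z.
Proof.
move=> Uip Ud z; have UB := isometryB Uip.
have Un x : bnorm (U x) = bnorm x by exact: bnorm_ip.
have /choice [u hu] : forall n : nat, exists x, bnorm (z - U x) < n.+1%:R^-1.
  by move=> n; apply: Ud; rewrite invr_gt0.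
have small e : 0 < e -> exists n0, forall n, (n0 <= n)%N -> bnorm (z - U (u n)) < e.
  move=> e0; exists (Num.bound e^-1) => n hn; apply: lt_trans (hu n) _.
  rewrite invf_plt ?posrE //; apply: lt_le_trans (archi_boundP _) _.
    by rewrite invr_ge0 ltW.
  by rewrite ler_nat leqW.
(* The approximants are Cauchy because their images are and [U] preserves norms. *)
have [|l hl] := @bcomplete _ X u.
  move=> e e0; have [n0 hn] := small (e / 2) ltac:(by rewrite divr_gt0).
  exists n0 => m n hm hn'; rewrite -Un UB (splitr e).
  by apply: le_lt_trans (bnorm_tri z _ _) _; rewrite [X in X + _]bnormB ltrD ?hn.
exists l; apply/eqP; rewrite -subr_eq0; apply/eqP/bnorm0_eq0/eqP.
rewrite eq_le bnorm_ge0 andbT; apply/ler_addgt0Pr => e e0; rewrite add0r.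
have e2 : 0 < e / 2 by rewrite divr_gt0.
have [n1 h1] := small _ e2; have [n2 h2] := hl _ e2.
apply: le_trans (bnorm_tri (U (u (maxn n1 n2))) _ _) _; rewrite (splitr e).
by rewrite lerD // ltW // 1?bnormB -?UB ?Un ?h1 ?h2 ?leq_maxl ?leq_maxr // bnormB h2 ?leq_maxr.
Qed.

End UnitaryTheory.
End Unitaries.

(** * Interior tensor products *)

Section Tensors.
Context (R : realType).

(* Unlike in [is_tensor], no closure is taken: this suffices for modules with a
   finite frame, and spares all limits. *)
Definition ftensor (A B D : cstar R) (X : corr A B) (Y : corr B D) (T : corr A D)
    (t : X -> Y -> T) : Prop :=
  is_tensor t /\ span (fun p : X * Y => t p.1 p.2).

Definition ftens (A B D : cstar R) (X : corr A B) (Y : corr B D) : Prop :=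
  exists (T : corr A D) (t : X -> Y -> T), ftensor t.

Lemma tensor_ip_lact (A B D : cstar R) (X : corr A B) (Y : corr B D) (T : corr A D)
    (t : X -> Y -> T) : is_tensor t -> forall a x y x' y',
  ip (t x y) (lact a (t x' y')) = ip y (lact (ip x (lact a x')) y').
Proof. by move=> ht a x y x' y'; rewrite -(tensor_lact ht) (tensor_ip ht). Qed.

Lemma tensor_suml (A B D : cstar R) (X : corr A B) (Y : corr B D) (T : corr A D)
    (t : X -> Y -> T) : is_tensor t -> forall (I : Type) (s : seq I) (f : I -> X) y,
  t (\sum_(i <- s) f i) y = \sum_(i <- s) t (f i) y.
Proof.
move=> ht I s f y; elim: s => [|i s IH]; last by rewrite !big_cons (tensorDl ht) IH.
by rewrite !big_nil -(scale0r (0 : X)) (tensorZl ht) !scale0r.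
Qed.

Lemma tensor_sumr (A B D : cstar R) (X : corr A B) (Y : corr B D) (T : corr A D)
    (t : X -> Y -> T) : is_tensor t -> forall (I : Type) (s : seq I) x (f : I -> Y),
  t x (\sum_(i <- s) f i) = \sum_(i <- s) t x (f i).
Proof.
move=> ht I s x f; elim: s => [|i s IH]; last by rewrite !big_cons (tensorDr ht) IH.
by rewrite !big_nil -(scale0r (0 : Y)) (tensorZr ht) !scale0r.
Qed.

Section Elt.
Variables (A B D : cstar R) (X : corr A B) (Y : corr B D).
Hypothesis XY : ftens X Y.

(** Any model makes the test in [tensor_choice] succeed, which excludes the zero default. *)
Lemma elt_is_tensor : is_tensor (@elt R A B D X Y).
Proof.
rewrite /elt /tens /tensor_choice; case: pselect => [h|[]].
  exact: (projT2 (cid h)).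
by have [T [t [ht _]]] := XY; exists (existT (fun T : corr A D => X -> Y -> T) T t).
Qed.

(** The chosen product is only known to be the closure of its elementary tensors. The model maps
    isometrically onto a dense part of it and is complete, so it maps onto everything; the chosen
    product is therefore spanned algebraically as well. *)
Lemma ftensor_tens (T : corr A D) (t : X -> Y -> T) : ftensor t ->
  exists U : T -> tens X Y, unitary U /\ forall x y, U (t x y) = elt x y.
Proof.
move=> [ht hs]; have he := elt_is_tensor.
have [|U [Uip Ut Us]] := isometric_extension hs (u := fun p => elt p.1 p.2).
  by move=> [x y] [x' y']; rewrite (tensor_ip ht) (tensor_ip he).
exists U; split=> [|x y]; last exact: (Ut (x, y)).
have UB := isometryB Uip.
have Usum (s : seq (X * Y)) :
    U (\sum_(p <- s) t p.1 p.2) = \sum_(p <- s) elt p.1 p.2.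
  elim: s => [|p s IH].
    by rewrite !big_nil -(subrr 0) UB subrr.
  have UN x : U (- x) = - U x by rewrite -sub0r UB -{1}(subrr 0) UB subrr sub0r.
  by rewrite !big_cons -[X in _ + X]opprK UB UN opprK IH Ut.
apply: unitary_of_ip => [//||a x y].
  apply: isometry_surj => // z e e0.
  have [s hse] := tensor_dense he z e0.
  by exists (\sum_(p <- s) t p.1 p.2); rewrite Usum.
have [s1 -> ->] := Us x; have [s2 -> ->] := Us y.
rewrite !ip_suml; apply: eq_bigr => i _; rewrite !lact_sumr !ip_sumr.
by apply: eq_bigr => j _; rewrite (tensor_ip_lact he) (tensor_ip_lact ht).
Qed.

Lemma span_elt : span (fun p : X * Y => elt p.1 p.2).
Proof.
have [T [t ht]] := XY; have [U [hU Ut]] := ftensor_tens ht.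
move=> z; have [w <-] := unitary_surj hU z; have [s ->] := ht.2 w.
by exists s; rewrite (unitary_sum hU); apply: eq_bigr => p _; rewrite Ut.
Qed.

Lemma ftensor_elt : ftensor (@elt R A B D X Y).
Proof. exact: conj elt_is_tensor span_elt. Qed.

End Elt.

Lemma tens_transport (A B D : cstar R) (X X' : corr A B) (Y Y' : corr B D)
    (T : corr A D) (t : X -> Y -> T) (U : X' -> X) (W : Y' -> Y) :
  ftensor t -> unitary U -> unitary W -> ftensor (fun x y => t (U x) (W y)).
Proof.
move=> [ht hs] hU hW.
have sp : span (fun p : X' * Y' => t (U p.1) (W p.2)).
  apply: span_sub hs _ => -[x y]; have [x' <-] := unitary_surj hU x.
  by have [y' <-] := unitary_surj hW y; exists [:: (x', y')]; rewrite big_seq1.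
split=> //; split.
- by move=> *; rewrite (unitaryD hU) (tensorDl ht).
- by move=> *; rewrite (unitaryD hW) (tensorDr ht).
- by move=> *; rewrite (unitaryZ hU) (tensorZl ht).
- by move=> *; rewrite (unitaryZ hW) (tensorZr ht).
- by move=> *; rewrite (unitary_ract hU) (unitary_lact hW) (tensor_balanced ht).
- by move=> *; rewrite (unitary_lact hU) (tensor_lact ht).
- by move=> *; rewrite (unitary_ract hW) (tensor_ract ht).
- by move=> *; rewrite (tensor_ip ht) (unitary_ip hU) -(unitary_lact hW) (unitary_ip hW).
- by move=> z e e0; have [s ->] := sp z; exists s; rewrite subrr bnorm0.
Qed.

Lemma ftens_transport (A B D : cstar R) (X X' : corr A B) (Y Y' : corr B D)
    (U : X -> X') (W : Y -> Y') :
  ftens X Y -> unitary U -> unitary W -> ftens X' Y'.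
Proof.
move=> [T [t ht]] /unitary_inv[U' [hU _ _]] /unitary_inv[W' [hW _ _]].
by eexists; eexists; exact: tens_transport ht hU hW.
Qed.

Lemma the_unitaryP (A B : cstar R) (X Y : corr A B) (P : (X -> Y) -> Prop) :
  (exists U, unitary U /\ P U) -> unitary (the_unitary P) /\ P (the_unitary P).
Proof.
rewrite /the_unitary; case: pselect => [h _|nh /nh //].
exact: (projT2 (cid h)).
Qed.

Lemma tensor_unitary (A B D : cstar R) (X X' : corr A B) (Y Y' : corr B D)
    (T : corr A D) (t : X -> Y -> T) (T' : corr A D) (t' : X' -> Y' -> T')
    (U : X -> X') (W : Y -> Y') :
  ftensor t -> ftensor t' -> unitary U -> unitary W ->
  exists V : T -> T', unitary V /\ forall x y, V (t x y) = t' (U x) (W y).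
Proof.
move=> ht ht' hU hW; have ht2 := tens_transport ht' hU hW.
have [i j|a i j|V [hV Vt]] := unitary_extension ht.2 ht2.2.
- by rewrite (tensor_ip ht.1) (tensor_ip ht2.1).
- by rewrite (tensor_ip_lact ht.1) (tensor_ip_lact ht2.1).
by exists V; split=> // x y; exact: (Vt (x, y)).
Qed.

Section TensLR.
Variables (A B D : cstar R).

Lemma tenslP (X X' : corr A B) (Y : corr B D) (U : X -> X') :
  ftens X Y -> unitary U -> unitary (tensl (Y := Y) U) /\
  forall (x : X) (y : Y), tensl U (elt x y) = elt (U x) y.
Proof.
move=> XY hU; apply: (the_unitaryP
  (P := fun T : tens X Y -> tens X' Y => forall (x : X) (y : Y), T (elt x y) = elt (U x) y)).
have XY' : ftens X' Y by exact: ftens_transport XY hU (unitary_id Y).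
exact: tensor_unitary (ftensor_elt XY) (ftensor_elt XY') hU (unitary_id Y).
Qed.

Lemma tensrP (X : corr A B) (Y Y' : corr B D) (U : Y -> Y') :
  ftens X Y -> unitary U -> unitary (tensr (X := X) U) /\
  forall (x : X) (y : Y), tensr U (elt x y) = elt x (U y).
Proof.
move=> XY hU; apply: (the_unitaryP
  (P := fun T : tens X Y -> tens X Y' => forall (x : X) (y : Y), T (elt x y) = elt x (U y))).
have XY' : ftens X Y' by exact: ftens_transport XY (unitary_id X) hU.
exact: tensor_unitary (ftensor_elt XY) (ftensor_elt XY') (unitary_id X) hU.
Qed.

End TensLR.

Section Assoc.
Variables (A B D E : cstar R) (X : corr A B) (Y : corr B D) (Z : corr D E).
Hypotheses (XY : ftens X Y) (YZ : ftens Y Z).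
Hypotheses (XY_Z : ftens (tens X Y) Z) (X_YZ : ftens X (tens Y Z)).

Let tl (p : X * Y * Z) := elt (elt p.1.1 p.1.2) p.2 : tens (tens X Y) Z.
Let tr (p : X * Y * Z) := elt p.1.1 (elt p.1.2 p.2) : tens X (tens Y Z).

Let hXY := ftensor_elt XY.
Let hYZ := ftensor_elt YZ.
Let hXY_Z := ftensor_elt XY_Z.
Let hX_YZ := ftensor_elt X_YZ.

Let span_tl : span tl.
Proof.
apply: span_sub hXY_Z.2 _ => -[u z] /=; have [s ->] := hXY.2 u.
exists [seq (p, z) | p <- s]; rewrite (tensor_suml hXY_Z.1) big_map.
by apply: eq_bigr => -[].
Qed.

Let span_tr : span tr.
Proof.
apply: span_sub hX_YZ.2 _ => -[x u] /=; have [s ->] := hYZ.2 u.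
exists [seq (x, p.1, p.2) | p <- s]; rewrite (tensor_sumr hX_YZ.1) big_map.
by apply: eq_bigr => -[].
Qed.

(** Both bracketings give the same expression, so the associator respects the left action; [ip_tlr]
    makes it isometric. *)
Let ip_tl a p q : ip (tl p) (lact a (tl q)) =
  ip p.2 (lact (ip p.1.2 (lact (ip p.1.1 (lact a q.1.1)) q.1.2)) q.2).
Proof. by rewrite /tl (tensor_ip_lact hXY_Z.1) (tensor_ip_lact hXY.1). Qed.

Let ip_tr a p q : ip (tr p) (lact a (tr q)) =
  ip p.2 (lact (ip p.1.2 (lact (ip p.1.1 (lact a q.1.1)) q.1.2)) q.2).
Proof. by rewrite /tr (tensor_ip_lact hX_YZ.1) (tensor_ip_lact hYZ.1). Qed.

Let ip_tlr p q : ip (tr p) (tr q) = ip (tl p) (tl q).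
Proof.
rewrite /tl /tr (tensor_ip hX_YZ.1) (tensor_ip_lact hYZ.1).
by rewrite (tensor_ip hXY_Z.1) (tensor_ip hXY.1).
Qed.

Lemma tens_assocP : unitary (@tens_assoc R A B D E X Y Z) /\
  forall (x : X) (y : Y) (z : Z), tens_assoc (elt (elt x y) z) = elt x (elt y z).
Proof.
apply: (the_unitaryP
  (P := fun T : tens (tens X Y) Z -> tens X (tens Y Z) =>
    forall (x : X) (y : Y) (z : Z), T (elt (elt x y) z) = elt x (elt y z))).
have [||U [hU Ut]] := unitary_extension span_tl span_tr.
- exact: ip_tlr.
- by move=> a i j; rewrite ip_tl ip_tr.
by exists U; split=> // x y z; exact: (Ut (x, y, z)).
Qed.

Lemma tens_assocVP : unitary (@tens_assocV R A B D E X Y Z) /\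
  forall (x : X) (y : Y) (z : Z), tens_assocV (elt x (elt y z)) = elt (elt x y) z.
Proof.
apply: (the_unitaryP
  (P := fun T : tens X (tens Y Z) -> tens (tens X Y) Z =>
    forall (x : X) (y : Y) (z : Z), T (elt x (elt y z)) = elt (elt x y) z)).
have [||U [hU Ut]] := unitary_extension span_tr span_tl.
- by move=> i j; rewrite ip_tlr.
- by move=> a i j; rewrite ip_tl ip_tr.
by exists U; split=> // x y z; exact: (Ut (x, y, z)).
Qed.

End Assoc.
End Tensors.

(** * Paths, evaluations and change of the left algebra *)

Section Models.
Context (R : realType).
Local Notation C := R[i].

Record star_hom (A' A : cstar R) := StarHom {
  hom_fun :> A' -> A;
  homD : forall a b, hom_fun (a + b) = hom_fun a + hom_fun b;
  homZ : forall (c : C) a, hom_fun (c *: a) = c *: hom_fun a;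
  homM : forall a b, hom_fun (cmul a b) = cmul (hom_fun a) (hom_fun b);
  hom_adj : forall a, hom_fun (cadj a) = cadj (hom_fun a);
  hom_norm : forall a, bnorm (hom_fun a) <= bnorm a }.

Section Pull.
Variables (A' A B : cstar R) (phi : star_hom A' A) (X : corr A B).

Fact pull_lactDl (a b : A') (x : X) :
  lact (phi (a + b)) x = lact (phi a) x + lact (phi b) x.
Proof. by rewrite homD lactDl. Qed.
Fact pull_lactZl (c : C) (a : A') (x : X) : lact (phi (c *: a)) x = c *: lact (phi a) x.
Proof. by rewrite homZ lactZl. Qed.
Fact pull_lactM (a b : A') (x : X) :
  lact (phi (cmul a b)) x = lact (phi a) (lact (phi b) x).
Proof. by rewrite homM lactM. Qed.
Fact pull_lact_adj (a : A') (x y : X) :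
  ip (lact (phi a) x) y = ip x (lact (phi (cadj a)) y).
Proof. by rewrite hom_adj lact_adj. Qed.
Fact pull_lact_norm (a : A') (x : X) : bnorm (lact (phi a) x) <= bnorm a * bnorm x.
Proof. by apply: le_trans (lact_norm _ _) _; rewrite ler_wpM2r ?bnorm_ge0 ?hom_norm. Qed.

Definition pull : corr A' B :=
  @Corr R A' B X (fun a x => lact (phi a) x)
    pull_lactDl pull_lactZl pull_lactM pull_lact_adj pull_lact_norm.

End Pull.

Lemma const_path_cont (B : banach R) (x : B) : path_continuous (fun=> x).
Proof. by move=> t e e0; exists 1 => // s _; rewrite subrr bnorm0. Qed.

Definition const_path (B : banach R) (x : B) : cpath B := mk_cpath (const_path_cont x).

Program Definition const_hom (A : cstar R) : star_hom A (path_cstar A) :=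
  @StarHom A (path_cstar A) (@const_path A) _ _ _ _ _.
Next Obligation. by move=> A *; exact: (@cpath_ext _ A). Qed.
Next Obligation. by move=> A *; exact: (@cpath_ext _ A). Qed.
Next Obligation. by move=> A *; exact: (@cpath_ext _ A). Qed.
Next Obligation. by move=> A *; exact: (@cpath_ext _ A). Qed.
Next Obligation. by move=> A a; exact: cpath_norm_le. Qed.

Program Definition eval_hom (A : cstar R) (t : unitI R) : star_hom (path_cstar A) A :=
  @StarHom (path_cstar A) A (fun f => f t) _ _ _ _ _.
Next Obligation. by []. Qed.
Next Obligation. by []. Qed.
Next Obligation. by []. Qed.
Next Obligation. by []. Qed.
Next Obligation. by move=> A t a; exact: cpath_norm_ge. Qed.

(** C(I, X) with [A] acting by constant functions; for a graph correspondence X this underlies the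
    homotopies below. *)
Definition const_path_corr (A B : cstar R) (X : corr A B) : corr A (path_cstar B) :=
  pull (const_hom A) (path_corr X).

Lemma exact_tensor (A B D : cstar R) (X : corr A B) (Y : corr B D) (T : corr A D)
    (t : X -> Y -> T) :
  (forall x x' y, t (x + x') y = t x y + t x' y) ->
  (forall x y y', t x (y + y') = t x y + t x y') ->
  (forall (c : C) x y, t (c *: x) y = c *: t x y) ->
  (forall (c : C) x y, t x (c *: y) = c *: t x y) ->
  (forall x b y, t (ract x b) y = t x (lact b y)) ->
  (forall a x y, t (lact a x) y = lact a (t x y)) ->
  (forall x y d, t x (ract y d) = ract (t x y) d) ->
  (forall x y x' y', ip (t x y) (t x' y') = ip y (lact (ip x x') y')) ->
  span (fun p : X * Y => t p.1 p.2) -> ftensor t.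
Proof.
move=> h1 h2 h3 h4 h5 h6 h7 h8 h9; split=> //; split=> // z e e0.
by have [s ->] := h9 z; exists s; rewrite subrr bnorm0.
Qed.

Lemma ftensor_pull (A' A B D : cstar R) (phi : star_hom A' A) (X : corr A B)
    (Y : corr B D) (T : corr A D) (t : X -> Y -> T) :
  ftensor t -> @ftensor R _ _ _ (pull phi X) Y (pull phi T) t.
Proof.
move=> [ht hs]; apply: exact_tensor => *.
- exact: (tensorDl ht).
- exact: (tensorDr ht).
- exact: (tensorZl ht).
- exact: (tensorZr ht).
- exact: (tensor_balanced ht).
- exact: (tensor_lact ht).
- exact: (tensor_ract ht).
- exact: (tensor_ip ht).
- exact: hs.
Qed.

Section PathTensor.
Variables (A B D : cstar R) (X : corr A B) (Y : corr B D) (T : corr A D).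
Variables (t : X -> Y -> T).
Hypothesis ht : ftensor t.

(** The squared norm is that of <y, <x, x> y>, which [ip_bound] controls with constant 6, and 6 is
    at most the square of 3. *)
Lemma tensor_bound (x : X) (y : Y) : bnorm (t x y) <= 3 * (bnorm x * bnorm y).
Proof.
rewrite -(@ler_pXn2r _ 2) ?nnegrE ?mulr_ge0 ?bnorm_ge0 // ip_norm (tensor_ip ht.1).
apply: le_trans (ip_bound _ _) _.
have := lact_norm (ip x x) y; rewrite -ip_norm.
have := bnorm_ge0 y; have := bnorm_ge0 x.
move: (bnorm (lact _ _)) (bnorm y) (bnorm x) => a b c c0 b0 h.
have k : b * a <= b * (c ^+ 2 * b) by rewrite ler_wpM2l.
have : 0 <= c ^+ 2 * b ^+ 2 by rewrite mulr_ge0 ?sqr_ge0.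
nra.
Qed.

Lemma tensorBl x x' y : t (x - x') y = t x y - t x' y.
Proof. by rewrite (tensorDl ht.1) -scaleN1r (tensorZl ht.1) scaleN1r. Qed.

Lemma tensorBr x y y' : t x (y - y') = t x y - t x y'.
Proof. by rewrite (tensorDr ht.1) -scaleN1r (tensorZr ht.1) scaleN1r. Qed.

Lemma path_tensor_cont (f : cpath X) (g : cpath Y) :
  path_continuous (fun u => t (f u) (g u)).
Proof. exact: bilin_continuous tensorBl tensorBr tensor_bound f g. Qed.

Definition path_tensor (f : path_corr X) (g : path_corr Y) : path_corr T :=
  mk_cpath (path_tensor_cont f g).

(** Constant first factors make one hypothesis serve both [ftensor_path] and [ftensor_const_path].
    Spanning at each time would not give it at once, as the sums must be chosen continuously in
    time. *)
Definition path_span : Prop := forall z : path_corr T, exists s : seq (X * path_corr Y),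
  z = \sum_(p <- s) path_tensor (const_path p.1) p.2.

Hypothesis hp : path_span.

Lemma ftensor_path : ftensor path_tensor.
Proof.
apply: exact_tensor => [f f' g|f g g'|c f g|c f g|f b g|a f g|f g d|f g f' g'|z].
- by apply: (@cpath_ext _ T) => u; exact: (tensorDl ht.1).
- by apply: (@cpath_ext _ T) => u; exact: (tensorDr ht.1).
- by apply: (@cpath_ext _ T) => u; exact: (tensorZl ht.1).
- by apply: (@cpath_ext _ T) => u; exact: (tensorZr ht.1).
- by apply: (@cpath_ext _ T) => u; exact: (tensor_balanced ht.1).
- by apply: (@cpath_ext _ T) => u; exact: (tensor_lact ht.1).
- by apply: (@cpath_ext _ T) => u; exact: (tensor_ract ht.1).
- by apply: (@cpath_ext _ D) => u; exact: (tensor_ip ht.1).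
have [s ->] := hp z; exists [seq (const_path p.1, p.2) | p <- s].
by rewrite big_map.
Qed.

Lemma ftensor_const_path :
  @ftensor R _ _ _ X (const_path_corr Y) (const_path_corr T)
    (fun x g => path_tensor (const_path x) g).
Proof.
apply: exact_tensor => [f f' g|f g g'|c f g|c f g|f b g|a f g|f g d|f g f' g'|z].
- by apply: (@cpath_ext _ T) => u; exact: (tensorDl ht.1).
- by apply: (@cpath_ext _ T) => u; exact: (tensorDr ht.1).
- by apply: (@cpath_ext _ T) => u; exact: (tensorZl ht.1).
- by apply: (@cpath_ext _ T) => u; exact: (tensorZr ht.1).
- by apply: (@cpath_ext _ T) => u; exact: (tensor_balanced ht.1).
- by apply: (@cpath_ext _ T) => u; exact: (tensor_lact ht.1).
- by apply: (@cpath_ext _ T) => u; exact: (tensor_ract ht.1).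
- by apply: (@cpath_ext _ D) => u; exact: (tensor_ip ht.1).
by have [s ->] := hp z; exists s.
Qed.

(** Only the value of [f] at [u] survives balancing, and constant paths realize all values. *)
Lemma ftensor_path_pull (u : unitI R) :
  @ftensor R _ _ _ (path_corr X) (pull (eval_hom B u) Y) (pull (eval_hom A u) T)
    (fun f y => t ((f : cpath X) u) y).
Proof.
apply: exact_tensor => [f f' g|f g g'|c f g|c f g|f b g|a f g|f g d|f g f' g'|z].
- exact: (tensorDl ht.1).
- exact: (tensorDr ht.1).
- exact: (tensorZl ht.1).
- exact: (tensorZr ht.1).
- exact: (tensor_balanced ht.1).
- exact: (tensor_lact ht.1).
- exact: (tensor_ract ht.1).
- exact: (tensor_ip ht.1).
have [s ->] := ht.2 z; exists [seq (const_path p.1, p.2) | p <- s].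
by rewrite big_map.
Qed.

End PathTensor.

(** The unit [e] gives surjectivity: [z] is the image of the constant path at [z] tensored with
    [e]. *)
Lemma ftensor_path_eval (A B : cstar R) (X : corr A B) (u : unitI R) (e : B) :
  (forall x : X, ract x e = x) ->
  @ftensor R _ _ _ (path_corr X) (eval_corr B u) (pull (eval_hom A u) X)
    (fun f b => ract ((f : cpath X) u) b).
Proof.
move=> he.
apply: exact_tensor => [f f' g|f g g'|c f g|c f g|f b g|a f g|f g d|f g f' g'|z].
- exact: ractDl.
- exact: ractDr.
- exact: ractZl.
- exact: ractZr.
- exact: esym (ractM _ _ _).
- exact: esym (lact_ract _ _ _).
- exact: ractM.
- by rewrite /= ipMr -ipC ipMr cadjM ipC cmulA.
by exists [:: (const_path z, e)]; rewrite big_seq1 /= he.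
Qed.

Lemma ftensor_eval (A B : cstar R) (X : corr A B) (u : unitI R) (e : A) :
  (forall x : X, lact e x = x) ->
  @ftensor R _ _ _ (eval_corr A u) X (pull (eval_hom A u) X) (fun a x => lact a x).
Proof.
move=> he.
apply: exact_tensor => [f f' g|f g g'|c f g|c f g|f b g|a f g|f g d|f g f' g'|z].
- exact: (@lactDl R A B X).
- exact: (@lactDr R A B X f g g').
- exact: (@lactZl R A B X).
- exact: (@lactZr R A B X f c g).
- exact: (@lactM R A B X).
- exact: (@lactM R A B X).
- exact: (@lact_ract R A B X f g d).
- by rewrite /= lact_adj lactM.
by exists [:: (e, z)]; rewrite big_seq1 /= he.
Qed.

End Models.

(** * Correspondences of graphs *)

Section Graphs.
Context (R : realType).
Local Notation C := R[i].

(** Edges form an arbitrary finite type, because composites and powers of matrix graphs are no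
    longer of the form [edge A]. *)
Record digraph (V W : finType) := Digraph {
  gedge :> finType; gsrc : gedge -> V; grng : gedge -> W }.

Definition gcorr (V W : finType) (E : digraph V W) : corr (fun_cstar R V) (fun_cstar R W) :=
  edge_corr R (@gsrc V W E) (@grng V W E).

Definition gcomp (V W U : finType) (E : digraph V W) (F : digraph W U) : digraph V U :=
  @Digraph V U {p in [pred p : E * F | grng p.1 == gsrc p.2]}
    (fun p => gsrc (sval p).1) (fun p => grng (sval p).2).

Section Delta.
Variables (V W : finType) (E : digraph V W).
Implicit Types (x : gcorr E) (e : E).

Definition delta e : gcorr E := [ffun f => (f == e)%:R].

Lemma delta_sum x : x = \sum_e (x : {ffun E -> C}) e *: delta e.
Proof.
apply/ffunP => f; rewrite sum_ffunE (bigD1 f) //= big1 ?addr0 => [|e ef].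
  by rewrite !ffunE eqxx -[RHS]/(_ * 1) mulr1.
by rewrite !ffunE eq_sym (negPf ef) scaler0.
Qed.

Lemma span_delta : span (fun p : C * E => p.1 *: delta p.2).
Proof.
move=> x; exists [seq ((x : {ffun E -> C}) e, e) | e <- enum E].
by rewrite big_map big_enum -delta_sum.
Qed.

Lemma ract_delta e (b : fun_cstar R W) :
  ract (delta e) b = (b : {ffun W -> C}) (grng e) *: delta e.
Proof.
apply/ffunP => f; rewrite !ffunE; case: eqP => [->|_].
  by rewrite mul1r -[RHS]/(_ * 1) mulr1.
by rewrite mul0r -[RHS]/(_ * 0) mulr0.
Qed.

Lemma lact_delta e (a : fun_cstar R V) :
  lact a (delta e) = (a : {ffun V -> C}) (gsrc e) *: delta e.
Proof.
apply/ffunP => f; rewrite !ffunE; case: eqP => [->//|_].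
by rewrite -[RHS]/(_ * 0) !mulr0.
Qed.

Definition one_fun (S : finType) : fun_cstar R S := [ffun=> 1].
Definition ind (S : finType) (v : S) : fun_cstar R S := [ffun w => (w == v)%:R].

Lemma ip_delta e x : ip (delta e) x = (x : {ffun E -> C}) e *: ind (grng e).
Proof.
apply/ffunP => w; rewrite !ffunE -[RHS]/(_ * _) big_mkcond (bigD1 e) //=.
rewrite big1 ?addr0 => [|f fe]; last first.
  by rewrite !ffunE (negPf fe) conjc_nat mul0r if_same.
rewrite !ffunE eqxx conjc_nat mul1r eq_sym.
by case: eqP; rewrite ?mulr1 ?mulr0.
Qed.

Lemma ract1 x : ract x (one_fun W) = x.
Proof. by apply/ffunP => e; rewrite !ffunE mulr1. Qed.

Lemma lact1 x : lact (one_fun V) x = x.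
Proof. by apply/ffunP => e; rewrite !ffunE mul1r. Qed.

End Delta.

Lemma cpath_sum (B : banach R) (I : Type) (s : seq I) (f : I -> cpath B) u :
  (\sum_(i <- s) f i) u = \sum_(i <- s) f i u.
Proof. by elim: s => [|i s IH]; rewrite ?big_nil // !big_cons cpathD IH. Qed.

(** * Tensor products of graph correspondences *)

Section GraphTensor.
Variables (V W U : finType) (E : digraph V W) (F : digraph W U).

Definition graph_tensor (x : gcorr E) (y : gcorr F) : gcorr (gcomp E F) :=
  [ffun p : gcomp E F =>
     (x : {ffun E -> C}) (val p).1 * (y : {ffun F -> C}) (val p).2].

Lemma graph_tensor_delta (p : gcomp E F) :
  graph_tensor (delta (val p).1) (delta (val p).2) = delta p.
Proof.
apply/ffunP => q; rewrite !ffunE -natrM mulnb -xpair_eqE -!surjective_pairing.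
by rewrite (inj_eq val_inj).
Qed.

Lemma graph_tensor_sum (z : gcorr (gcomp E F)) :
  z = \sum_p graph_tensor (delta (val p).1)
                ((z : {ffun gcomp E F -> C}) p *: delta (val p).2).
Proof.
rewrite [LHS]delta_sum; apply: eq_bigr => p _; rewrite -graph_tensor_delta.
by apply/ffunP => q; rewrite !ffunE mulrCA.
Qed.

(** Balancing over c(W) is the composability condition on pairs. For the inner product, the sum over
    composable pairs is grouped by the second edge, the inner sum being the inner product of the
    first factors at its source. *)
Lemma ftensor_graph : ftensor graph_tensor.
Proof.
apply: exact_tensor => [f f' g|f g g'|c f g|c f g|f b g|a f g|f g d|f g f' g'|z].
- by apply/ffunP => p; rewrite !ffunE mulrDl.
- by apply/ffunP => p; rewrite !ffunE mulrDr.
- by apply/ffunP => p; rewrite !ffunE; exact: esym (mulrA _ _ _).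
- by apply/ffunP => p; rewrite !ffunE; exact: mulrCA.
- by apply/ffunP => p; rewrite !ffunE (eqP (valP p)) mulrA.
- by apply/ffunP => p; rewrite !ffunE mulrA.
- by apply/ffunP => p; rewrite !ffunE mulrA.
- apply/ffunP => u; rewrite !ffunE.
  pose G (e : E) (h : F) := conjc ((f : {ffun E -> C}) e * (g : {ffun F -> C}) h) *
    ((f' : {ffun E -> C}) e * (g' : {ffun F -> C}) h).
  transitivity (\sum_(e : E) \sum_(h : F | (grng e == gsrc h) && (grng h == u)) G e h).
    rewrite pair_big_dep /= (big_sub_cond [pred p : E * F | grng p.1 == gsrc p.2]
      [pred p : E * F | grng p.2 == u] (fun p => G p.1 p.2)).
    by apply: eq_bigr => p _; rewrite !ffunE.
  rewrite (exchange_big_dep (fun h : F => grng h == u)) /=; last by move=> e h _ /andP[].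
  apply: eq_bigr => h hu; rewrite !ffunE mulr_suml mulr_sumr.
  rewrite [LHS](eq_bigl (fun e => grng e == gsrc h)); last by move=> e; rewrite hu andbT.
  by apply: eq_bigr => e _; rewrite /G rmorphM mulrACA mulrCA mulrA.
exists [seq (delta (val p).1, (z : {ffun gcomp E F -> C}) p *: delta (val p).2)
  | p <- enum (gcomp E F)].
by rewrite big_map big_enum /= -graph_tensor_sum.
Qed.

(** The coefficients in [graph_tensor_sum] depend continuously on the vector, so that formula
    applies to a whole path at once, with each coefficient path put into the second factor. *)
Lemma graph_path_span : path_span ftensor_graph.
Proof.
move=> z.
have zc p : path_continuous (fun u =>
    (cpath_fun (z : cpath (gcorr (gcomp E F))) u : {ffun gcomp E F -> C}) p *: delta (val p).2).
  apply: (@bilin_continuous _ (gcorr (gcomp E F)) (gcorr F) (gcorr F) 1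
    (fun w y => (w : {ffun gcomp E F -> C}) p *: y) _ _ _ z (const_path _)).
  - by move=> x x' y; rewrite !ffunE scalerBl.
  - by move=> x y y'; rewrite scalerBr.
  - move=> x y; rewrite bnormZ mul1r ler_wpM2r ?bnorm_ge0 //.
    exact: (@edge_norm_coord R _ _ (@grng _ _ (gcomp E F))).
exists [seq (delta (val p).1, mk_cpath (zc p) : path_corr (gcorr F)) | p <- enum (gcomp E F)].
apply: (@cpath_ext _ (gcorr (gcomp E F))) => u.
rewrite big_map big_enum cpath_sum /=; exact: graph_tensor_sum.
Qed.

End GraphTensor.

Section GraphUnitary.
Variables (V W : finType).
Implicit Types E F : digraph V W.

Lemma graph_unitary_eq E (K : corr (fun_cstar R V) (fun_cstar R W)) (f g : gcorr E -> K) :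
  unitary f -> unitary g -> (forall e, f (delta e) = g (delta e)) -> f =1 g.
Proof.
move=> hf hg h; apply: (span_unitary_eq (@span_delta _ _ E) hf hg) => -[c e].
by rewrite (unitaryZ hf) (unitaryZ hg) h.
Qed.

Lemma graph_iso_unitary E F (f : E -> F) : bijective f ->
  (forall e, gsrc (f e) = gsrc e) -> (forall e, grng (f e) = grng e) ->
  exists U : gcorr E -> gcorr F, unitary U /\ forall e, U (delta e) = delta (f e).
Proof.
move=> [f' fK f'K] fs fr.
have dl e e' : ip (delta (f e)) (delta (f e')) = ip (delta e) (delta e').
  by rewrite !ip_delta fr !ffunE (can_eq fK).
have [||a i j|U [hU Ut]] := unitary_extension (@span_delta _ _ E)
    (u := fun p : C * E => p.1 *: delta (f p.2)).
- apply: span_sub (@span_delta _ _ F) _ => -[c e] /=.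
  by exists [:: (c, f' e)]; rewrite big_seq1 /= f'K.
- by move=> i j; rewrite !(ipZl, ipZr) dl.
- by rewrite !(lactZr, lact_delta, ipZl, ipZr) dl fs.
exists U; split=> // e; have := Ut (1, e); rewrite /= !scale1r; exact.
Qed.

End GraphUnitary.

Section GraphTens.
Variables (V W U : finType) (E : digraph V W) (F : digraph W U).
Variables (K : corr (fun_cstar R V) (fun_cstar R W)) (L : corr (fun_cstar R W) (fun_cstar R U)).
Variables (g : gcorr E -> K) (h : gcorr F -> L).
Hypotheses (hg : unitary g) (hh : unitary h).

(** [K] and [L] are graph correspondences only up to a unitary, as chosen tensor products are; this
    allows iteration. *)
Lemma ftens_graph : ftens K L.
Proof.
apply: ftens_transport hg hh; exists (gcorr (gcomp E F)), (@graph_tensor _ _ _ E F).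
exact: ftensor_graph.
Qed.

Lemma graph_tens_unitary : exists theta : gcorr (gcomp E F) -> tens K L,
  unitary theta /\ forall x y, theta (graph_tensor x y) = elt (g x) (h y).
Proof.
exact: tensor_unitary (ftensor_graph E F) (ftensor_elt ftens_graph) hg hh.
Qed.

End GraphTens.
End Graphs.

(** * Homotopies from paths of unitaries *)

Section Homotopy.
Context (R : realType).
Local Notation C := R[i].

(** Continuity is asked for each vector separately; since the unitaries are isometric, this suffices
    to act on paths of vectors. *)
Record unitary_path (A B : cstar R) (X Y : corr A B) (w : unitI R -> X -> Y) : Prop :=
  UnitaryPath {
    upath_unitary : forall t, unitary (w t);
    upath_cont : forall x, path_continuous (fun t => w t x) }.

Section PathApply.
Variables (A B : cstar R) (X Y : corr A B) (w : unitI R -> X -> Y).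
Hypothesis hw : unitary_path w.

Lemma path_apply_cont (f : cpath X) : path_continuous (fun t => w t (f t)).
Proof.
move=> t e e0; have e2 : 0 < e / 2 by rewrite divr_gt0.
have [d1 p1 h1] := upath_cont hw (f t) t e2.
have [d2 p2 h2] := cpath_cont f t e2.
exists (Num.min d1 d2); first by rewrite lt_min p1.
move=> s; rewrite lt_min => /andP[k1 k2].
apply: le_lt_trans (bnorm_tri (w s (f t)) _ _) _; rewrite (splitr e) ltrD ?h1 //.
by rewrite -(unitaryB (upath_unitary hw s)) (unitary_norm (upath_unitary hw s)) h2.
Qed.

Definition path_apply (f : const_path_corr X) : const_path_corr Y :=
  mk_cpath (path_apply_cont f).

(** The pointwise preimage is continuous: as [w s] is isometric, the distance of [g s] and [g t] is
    that of [f s] and [w s (g t)], and the latter is close to [w t (g t) = f t]. *)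
Lemma path_apply_surj (f : cpath Y) : exists g : cpath X, forall t, w t (g t) = f t.
Proof.
have /choice [g hg] t : exists x, w t x = f t by exact: unitary_surj (upath_unitary hw t) _.
have gc : path_continuous g.
  move=> t e e0; have e2 : 0 < e / 2 by rewrite divr_gt0.
  have [d1 p1 h1] := upath_cont hw (g t) t e2.
  have [d2 p2 h2] := cpath_cont f t e2.
  exists (Num.min d1 d2); first by rewrite lt_min p1.
  move=> s; rewrite lt_min => /andP[k1 k2].
  rewrite -(unitary_norm (upath_unitary hw s)) (unitaryB (upath_unitary hw s)).
  apply: le_lt_trans (bnorm_tri (w t (g t)) _ _) _; rewrite (splitr e) ltrD //.
    by rewrite !hg h2.
  by rewrite bnormB h1.
by exists (mk_cpath gc) => t; exact: hg.
Qed.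

Lemma path_apply_unitary : unitary path_apply.
Proof.
apply: unitary_of_ip => [f g|f|a f g].
- by apply: (@cpath_ext _ B) => t; exact: (unitary_ip (upath_unitary hw t)).
- have [g hg] := path_apply_surj f; exists g.
  by apply: (@cpath_ext _ Y) => t; exact: hg.
- apply: (@cpath_ext _ B) => t /=.
  by rewrite -(unitary_lact (upath_unitary hw t)) (unitary_ip (upath_unitary hw t)).
Qed.

End PathApply.

(** * The 1-arrow of a path of unitaries and its fibres *)

Section Criterion.
Variables (V : finType) (E F : digraph V V).
Local Notation X := (@Obj R (fun_cstar R V) (gcorr R E)).
Local Notation Y := (gcorr R F).
Local Notation H := (const_path_corr (gcorr R F)).
Local Notation IX := (path_corr (gcorr R E)).
Local Notation EF := (gcorr R (gcomp E F)).
Local Notation FE := (gcorr R (gcomp F E)).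
Local Notation one := (one_fun R V).
Local Notation ev t := (eval_corr (fun_cstar R V) t).

(* The composite of the constants with evaluation is the identity of [c(V)]. *)
Lemma const_eval_unitary (t : unitI R) :
  @unitary R _ _ Y (pull (const_hom _) (pull (eval_hom _ t) Y)) id.
Proof. by apply: unitary_of_ip => // y; exists y. Qed.

(** Explicit models of the tensor products met by [arrow_comp_map]: C(I, X(EF)) for X (x) H, C(I,
    X(FE)) for H (x) C(I, X), and fibres at [t] wherever an evaluation enters. *)
Let hEF := ftensor_const_path (@graph_path_span R _ _ _ E F).
Let hFE : @ftensor R _ _ _ H IX (const_path_corr FE) _ :=
  ftensor_pull (const_hom _) (ftensor_path (@graph_path_span R _ _ _ F E)).
Let hHev t : @ftensor R _ _ _ H (ev t) (pull (const_hom _) (pull (eval_hom _ t) Y)) _ :=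
  ftensor_pull (const_hom _) (ftensor_path_eval t (@ract1 R _ _ F)).
Let hIXev t := ftensor_path_eval t (@ract1 R _ _ E).
Let hevX t := ftensor_eval t (@lact1 R _ _ E).
Let hHpull t : @ftensor R _ _ _ H (pull (eval_hom _ t) (gcorr R E))
    (pull (const_hom _) (pull (eval_hom _ t) FE)) _ :=
  ftensor_pull (const_hom _) (ftensor_path_pull (ftensor_graph R F E) t).

Lemma ftens_XH : ftens X H. Proof. by do 2 eexists; exact: hEF. Qed.
Lemma ftens_HIX : ftens H IX. Proof. by do 2 eexists; exact: hFE. Qed.
Lemma ftens_Hev t : ftens H (ev t). Proof. by do 2 eexists; exact: hHev. Qed.
Lemma ftens_IXev t : ftens IX (ev t). Proof. by do 2 eexists; exact: hIXev. Qed.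
Lemma ftens_evX t : ftens (ev t) X. Proof. by do 2 eexists; exact: hevX. Qed.

Lemma Hev_unitary t : exists U : Y -> tens H (ev t),
  unitary U /\ forall (h : cpath Y) (a : fun_cstar R V),
    U (ract (h t) a) = @elt R _ _ _ H (ev t) h a.
Proof.
have [U [hU Ue]] := ftensor_tens (ftens_Hev t) (hHev t).
exists U; split; last exact: Ue.
exact: (unitary_comp (const_eval_unitary t) hU).
Qed.

Lemma ftens_const_eval (G : digraph V V) t : ftens (const_path_corr (gcorr R G)) (ev t).
Proof.
do 2 eexists.
exact: (ftensor_pull (const_hom _) (ftensor_path_eval t (@ract1 R _ _ G))).
Qed.

Lemma ftens_XH_ev t : ftens (tens X H) (ev t).
Proof.
have [U [hU _]] := ftensor_tens ftens_XH hEF.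
exact: ftens_transport (ftens_const_eval _ t) hU (unitary_id _).
Qed.

Lemma ftens_HIX_ev t : ftens (tens H IX) (ev t).
Proof.
have [U [hU _]] := ftensor_tens ftens_HIX hFE.
exact: ftens_transport (ftens_const_eval _ t) hU (unitary_id _).
Qed.

Lemma ftens_X_Hev t : ftens X (tens H (ev t)).
Proof. by have [U [hU _]] := Hev_unitary t; exact: ftens_graph (unitary_id _) hU. Qed.

Lemma ftens_Hev_X t : ftens (tens H (ev t)) X.
Proof. by have [U [hU _]] := Hev_unitary t; exact: ftens_graph hU (unitary_id _). Qed.

Lemma ftens_H_IXev t : ftens H (tens IX (ev t)).
Proof.
have [U [hU _]] := ftensor_tens (ftens_IXev t) (hIXev t).
apply: ftens_transport (unitary_id _) hU.
by do 2 eexists; exact: hHpull.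
Qed.

Lemma ftens_H_evX t : ftens H (tens (ev t) X).
Proof.
have [U [hU _]] := ftensor_tens (ftens_evX t) (hevX t).
apply: ftens_transport (unitary_id _) hU.
by do 2 eexists; exact: hHpull.
Qed.

(** Through the models [U] and [W] both sides become X, so [W] after the inverse of [U] has the
    prescribed values. The formula is the prescription at b = 1. *)
Lemma eval_mapP t : unitary (@eval_map R X t) /\
  forall (f : cpath (gcorr R E)) (a : fun_cstar R V),
  @eval_map R X t (@elt R _ _ _ IX (ev t) f a) = @elt R _ _ _ (ev t) X one (ract (f t) a).
Proof.
have [U [hU Ue]] := ftensor_tens (ftens_IXev t) (hIXev t).
have [W [hW We]] := ftensor_tens (ftens_evX t) (hevX t).
have [U' [hU' UK _]] := unitary_inv hU.
have [h1 h2] := the_unitaryP (P := fun T : tens IX (ev t) -> tens (ev t) X =>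
  forall (f : cpath (gcorr R E)) (a b : fun_cstar R V) (x : gcorr R E),
    ract (f t) a = lact b x ->
    T (@elt R _ _ _ IX (ev t) f a) = @elt R _ _ _ (ev t) X b x)
  (ex_intro _ (W \o U') (conj (unitary_comp hU' hW)
    (fun f a b x e => etrans (congr1 W (etrans (congr1 U' (esym (Ue f a))) (UK _)))
       (etrans (congr1 W e) (We b x))))).
by split=> // f a; apply: h2; rewrite lact1.
Qed.

Variable w : unitI R -> EF -> FE.
Hypothesis hw : unitary_path w.

(** In the models, Phi is the action of [w] on paths. Its values are recorded as finite sums of
    elementary tensors because the associators and [tensr] are computed only on these. *)
Lemma path_arrow_map_ex : exists Phi : tens X H -> tens H IX,
  unitary Phi /\ forall x (h : cpath Y), exists s : seq (Y * IX),
    Phi (@elt R _ _ _ X H x h) =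
      \sum_(p <- s) @elt R _ _ _ H IX (const_path p.1) p.2 /\
    forall t, \sum_(p <- s) graph_tensor p.1 ((p.2 : cpath (gcorr R E)) t) =
      w t (graph_tensor x (h t)).
Proof.
have [U [hU Ue]] := ftensor_tens ftens_XH hEF.
have [W [hW We]] := ftensor_tens ftens_HIX hFE.
have [U' [hU' UK _]] := unitary_inv hU.
exists (W \o path_apply hw \o U'); split.
  exact: (unitary_comp hU' (unitary_comp (path_apply_unitary hw) hW)).
move=> x h; rewrite /= -Ue UK.
set z := path_apply hw _; have [s hs] := @graph_path_span R _ _ _ F E z.
exists s; split=> [|t].
  by rewrite {1}hs (unitary_sum hW); apply: eq_bigr => p _; exact: We.
have -> : w t (graph_tensor x (h t)) = (z : cpath FE) t by [].
by rewrite hs cpath_sum.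
Qed.

Section Arrow.
Variable Phi : tens X H -> tens H IX.
Hypothesis hPhi : unitary Phi.
Hypothesis Phi_elt : forall x (h : cpath Y), exists s : seq (Y * IX),
  Phi (@elt R _ _ _ X H x h) =
    \sum_(p <- s) @elt R _ _ _ H IX (const_path p.1) p.2 /\
  forall t, \sum_(p <- s) graph_tensor p.1 ((p.2 : cpath (gcorr R E)) t) =
    w t (graph_tensor x (h t)).

Local Notation AH := (@Arrow R X (path_obj X) H Phi).
Local Notation Ht t := (@arrow_comp R X (path_obj X) X AH (eval_arrow X t)).

Lemma path_arrow_comp_unitary t :
  unitary (@arrow_comp_map R _ _ _ AH (eval_arrow X t)).
Proof.
have h1 := (tens_assocVP ftens_XH (ftens_Hev t) (ftens_XH_ev t) (ftens_X_Hev t)).1.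
have h2 := (tenslP (ftens_XH_ev t) hPhi).1.
have h3 := (tens_assocP ftens_HIX (ftens_IXev t) (ftens_HIX_ev t) (ftens_H_IXev t)).1.
have h4 := (tensrP (ftens_H_IXev t) (eval_mapP t).1).1.
have h5 := (tens_assocVP (ftens_Hev t) (ftens_evX t) (ftens_Hev_X t) (ftens_H_evX t)).1.
exact: (unitary_comp h1 (unitary_comp h2 (unitary_comp h3 (unitary_comp h4 h5)))).
Qed.

(** Each of the five maps in [arrow_comp_map] is computed on elementary tensors; evaluated at [t],
    the sum recorded in [Phi_elt] reassembles to a value of [w t]. *)
Lemma path_arrow_comp t (theta : FE -> tens (tens H (ev t)) X) : unitary theta ->
  (forall y x, theta (graph_tensor y x) =
     @elt R _ _ _ (tens H (ev t)) X (@elt R _ _ _ H (ev t) (const_path y) one) x) ->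
  forall x (h : cpath Y) (a : fun_cstar R V),
    @arrow_comp_map R _ _ _ AH (eval_arrow X t)
      (@elt R _ _ _ X (tens H (ev t)) x (@elt R _ _ _ H (ev t) h a)) =
    ract (theta (w t (graph_tensor x (h t)))) a.
Proof.
move=> hth theta_e x h a; rewrite /arrow_comp_map.
have h1 := (tens_assocVP ftens_XH (ftens_Hev t) (ftens_XH_ev t) (ftens_X_Hev t)).2.
have h2 := (tenslP (ftens_XH_ev t) hPhi).2.
have [u3 h3] := (tens_assocP ftens_HIX (ftens_IXev t) (ftens_HIX_ev t) (ftens_H_IXev t)).
have [u4 h4] := (tensrP (ftens_H_IXev t) (eval_mapP t).1).
have [u5 h5] := (tens_assocVP (ftens_Hev t) (ftens_evX t) (ftens_Hev_X t) (ftens_H_evX t)).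
rewrite h1 [tensl _ _]h2; have [s [-> hs]] := Phi_elt x h.
rewrite -hs (tensor_suml (elt_is_tensor (ftens_HIX_ev t))).
rewrite (unitary_sum u3) [tensr _ _](unitary_sum u4) (unitary_sum u5).
rewrite (unitary_sum hth) ract_suml; apply: eq_bigr => p _.
rewrite h3 h4 (eval_mapP t).2 h5 theta_e.
by rewrite (tensor_ract (elt_is_tensor (ftens_Hev_X t))).
Qed.

Lemma path_arrow_2arrow t (G : arrow X X) (g : Y -> G) (theta : FE -> tens G X) :
  unitary (@amap R X X G) -> unitary g -> unitary theta ->
  (forall y x, theta (graph_tensor y x) = @elt R _ _ _ G X (g y) x) ->
  (forall x y, @amap R X X G (@elt R _ _ _ X G x (g y)) = theta (w t (graph_tensor x y))) ->
  exists h0, @is_2arrow R X X (Ht t) G h0.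
Proof.
move=> hG hg hth theta_e hw'.
have [U [hU Ue]] := Hev_unitary t.
have [U' [hU' UK _]] := unitary_inv hU.
pose h0 := g \o U'; have hh0 : unitary h0 := unitary_comp hU' hg.
have h0e (h : cpath Y) a : h0 (@elt R _ _ _ H (ev t) h a) = g (ract (h t) a).
  by rewrite -Ue /h0 /= UK.
exists h0; split=> //.
have [l1 l2] := tenslP (ftens_Hev_X t) hh0.
have [r1 r2] := tensrP (ftens_X_Hev t) hh0.
(* Both sides of the 2-arrow identity are unitary, so comparing them on this spanning family
   suffices. *)
have sp : span (fun p : X * (H * ev t) =>
    @elt R _ _ _ X (tens H (ev t)) p.1 (@elt R _ _ _ H (ev t) p.2.1 p.2.2)).
  apply: span_sub (span_elt (ftens_X_Hev t)) _ => -[x u] /=.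
  have [s ->] := span_elt (ftens_Hev t) u.
  exists [seq (x, p) | p <- s].
  by rewrite (tensor_sumr (elt_is_tensor (ftens_X_Hev t))) big_map.
apply: (span_unitary_eq sp (unitary_comp (path_arrow_comp_unitary t) l1)
  (unitary_comp r1 hG)) => -[x [h a]] /=.
have Uconst (y : Y) : U y = @elt R _ _ _ H (ev t) (const_path y) one.
  by rewrite -Ue ract1.
have [th' [hth' th'e]] := graph_tens_unitary hU (unitary_id X).
rewrite (path_arrow_comp hth') => [|y x']; last by rewrite th'e Uconst.
rewrite (unitary_ract l1) [tensr _ _]r2 h0e (unitary_ract hg).
have gX : ftens X G by exact: ftens_graph (unitary_id X) hg.
rewrite (tensor_ract (elt_is_tensor gX)) (unitary_ract hG) hw'.
congr ract.
(* The identifications of X(FE) through the fibre of H and through [G] differ by [h0] (x) 1. *)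
apply: (span_unitary_eq (ftensor_graph R F E).2 (unitary_comp hth' l1) hth) => -[y x'] /=.
by rewrite th'e [tensl _ _]l2 theta_e /h0 /= UK.
Qed.

End Arrow.
End Criterion.
End Homotopy.

(** * Paths of unitaries ending at an involution *)

Section Connected.
Context (R : realType).
Local Notation C := R[i].

Definition half_turn (t : unitI R) : C :=
  (cos (pi * sval t) +i* sin (pi * sval t))%C.

Lemma half_turn_conj t : conjc (half_turn t) * half_turn t = 1.
Proof.
rewrite conjc_mul /= sqr_sqrtr ?addr_ge0 ?sqr_ge0 //.
by rewrite cos2Dsin2.
Qed.

Lemma half_turn0 : half_turn (clamp 0) = 1.
Proof.
rewrite /half_turn /=; have -> : Num.max 0 (Num.min 1 0) = 0 :> R.
  by rewrite (min_idPr ler01) (max_idPl (lexx _)).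
by rewrite mulr0 cos0 sin0.
Qed.

Lemma half_turn1 : half_turn (clamp 1) = -1.
Proof.
rewrite /half_turn /=; have -> : Num.max 0 (Num.min 1 1) = 1 :> R.
  by rewrite minxx (max_idPr ler01).
by rewrite mulr1 cospi sinpi; apply/eqP; rewrite eq_complex /= oppr0 !eqxx.
Qed.

Lemma half_turn_cont t (e : R) : 0 < e -> exists2 d : R, 0 < d &
  forall s, `|sval s - sval t| < d -> ComplexField.Normc.normc (half_turn s - half_turn t) < e.
Proof.
move=> e0; have e2 : 0 < e / 2 by rewrite divr_gt0.
have hc : {for sval t, continuous (fun x : R => cos (pi * x))}%classic.
  apply: continuous_comp; last exact: continuous_cos.
  exact: mulrl_continuous.
have hs : {for sval t, continuous (fun x : R => sin (pi * x))}%classic.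
  apply: continuous_comp; last exact: continuous_sin.
  exact: mulrl_continuous.
move/cvgrPdist_lt: hc => /(_ _ e2) [d1 p1 h1].
move/cvgrPdist_lt: hs => /(_ _ e2) [d2 p2 h2].
exists (Num.min d1 d2); first by rewrite lt_min; apply/andP.
move=> s; rewrite lt_min distrC => /andP[k1 k2].
apply: le_lt_trans (normc_le_sum _) _; rewrite (splitr e).
by rewrite !raddfB /= distrC ltrD ?h1 // distrC h2.
Qed.

Section Involution.
Variables (A B : cstar R) (X : corr A B) (T : X -> X).
Hypotheses (hT : unitary T) (TT : forall x, T (T x) = x).

Let a t : C := (1 + half_turn t) / 2.
Let b t : C := (1 - half_turn t) / 2.

(** With P = (1 + T)/2 and Q = (1 - T)/2 this is P + c Q, where c is [half_turn t]: the eigenspace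
    of 1 stays fixed and that of -1 is rotated by c. *)
Definition involution_path t (x : X) : X := a t *: x + b t *: T x.

Lemma involution_path0 x : involution_path (clamp 0) x = x.
Proof.
by rewrite /involution_path /a /b half_turn0 subrr mul0r scale0r addr0 divff ?scale1r.
Qed.

Lemma involution_path1 x : involution_path (clamp 1) x = T x.
Proof.
by rewrite /involution_path /a /b half_turn1 subrr mul0r scale0r add0r opprK divff ?scale1r.
Qed.

Let conj_half (z : C) : conjc (z / 2) = conjc z / 2.
Proof. by rewrite rmorphM fmorphV rmorph_nat. Qed.

Let conj1D (z : C) : conjc (1 + z) = 1 + conjc z.
Proof. by rewrite rmorphD rmorph1. Qed.

Let conj1B (z : C) : conjc (1 - z) = 1 - conjc z.
Proof. by rewrite rmorphB rmorph1. Qed.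

Let ab1 t : conjc (a t) * a t + conjc (b t) * b t = 1.
Proof.
rewrite /a /b !conj_half conj1D conj1B.
have := half_turn_conj t; move: (half_turn t) => c.
move: (conjc c) => c' h.
have -> : (1 + c') / 2 * ((1 + c) / 2) + (1 - c') / 2 * ((1 - c) / 2) = (1 + c' * c) / 2.
  by field.
by rewrite h divff.
Qed.

Let ab0 t : conjc (a t) * b t + conjc (b t) * a t = 0.
Proof.
rewrite /a /b !conj_half conj1D conj1B.
have := half_turn_conj t; move: (half_turn t) => c.
move: (conjc c) => c' h.
have -> : (1 + c') / 2 * ((1 - c) / 2) + (1 - c') / 2 * ((1 + c) / 2) = (1 - c' * c) / 2.
  by field.
by rewrite h subrr mul0r.
Qed.

Let combine (M : lmodType C) (c1 c2 c3 c4 : C) (p q : M) : c1 + c4 = 1 -> c2 + c3 = 0 ->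
  c1 *: p + c2 *: q + (c3 *: q + c4 *: p) = p.
Proof.
move=> h1 h2; rewrite [c3 *: q + _]addrC addrACA -!scalerDl h1 h2.
by rewrite scale0r addr0 scale1r.
Qed.

Let Tsym x y : ip (T x) y = ip x (T y).
Proof. by rewrite -(unitary_ip hT) TT. Qed.

Let ip_path t x y : ip (involution_path t x) (involution_path t y) = ip x y.
Proof.
rewrite !(ipDl, ipDr, ipZl, ipZr) (unitary_ip hT) Tsym !scalerDr !scalerA.
by rewrite combine ?ab1 ?ab0.
Qed.

(** The preimage is the adjoint of [involution_path t] applied to [y]. *)
Let path_surj t y : involution_path t (conjc (a t) *: y + conjc (b t) *: T y) = y.
Proof.
rewrite /involution_path (unitaryD hT) !(unitaryZ hT) TT !scalerDr !scalerA.
rewrite ![a t * _]mulrC ![b t * _]mulrC.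
rewrite combine ?ab1 //.
by rewrite addrC ab0.
Qed.

Lemma involution_path_unitary : unitary_path involution_path.
Proof.
split=> [t|x t e e0].
  apply: unitary_of_ip => [x y|y|c x y]; first exact: ip_path.
    by eexists; exact: path_surj.
  rewrite -(ip_path t y); congr ip.
  by rewrite /involution_path lactDr !lactZr (unitary_lact hT).
pose K := 1 + bnorm x; have K0 : 0 < K by rewrite ltr_pwDl ?bnorm_ge0.
have [d d0 hd] := half_turn_cont t (e := e / K) ltac:(by rewrite divr_gt0).
exists d => // s /hd.
(* Only the component (x - T x)/2 in the eigenspace of -1 moves. *)
have -> : involution_path s x - involution_path t x =
    ((half_turn s - half_turn t) / 2) *: (x - T x).
  rewrite /involution_path opprD addrACA -!scalerBl.
  have -> : b s - b t = - (a s - a t) by rewrite /a /b; field.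
  have -> : (half_turn s - half_turn t) / 2 = a s - a t by rewrite /a; field.
  by rewrite scaleNr scalerBr.
rewrite bnormZ ComplexField.Normc.normcM ltr_pdivlMr // => h.
apply: le_lt_trans h.
have n2 : ComplexField.Normc.normc (2^-1 : C) = 2^-1.
  rewrite -[RHS]ger0_norm ?invr_ge0 // -normc_real; congr ComplexField.Normc.normc.
  by rewrite fmorphV /= rmorph_nat.
have nT : bnorm (x - T x) <= 2 * bnorm x.
  apply: le_trans (bnormD _ _) _.
  by rewrite bnormN (unitary_norm hT) mulrDl !mul1r.
rewrite n2 -mulrA ler_wpM2l ?normc_ge0 // /K; lra.
Qed.
End Involution.
End Connected.

(** * Unitaries permuting the edges *)

Section Monomial.
Context (R : realType).
Local Notation C := R[i].

Definition path_connected (A B : cstar R) (X Y : corr A B) (U U' : X -> Y) : Prop :=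
  exists w : unitI R -> X -> Y,
    [/\ unitary_path w, w (clamp 0) =1 U & w (clamp 1) =1 U'].

Lemma path_connected_refl (A B : cstar R) (X Y : corr A B) (U U' : X -> Y) :
  unitary U -> U =1 U' -> path_connected U U'.
Proof.
move=> hU e; exists (fun=> U); split=> //; split=> // x.
exact: const_path_cont.
Qed.

Lemma path_connected_comp (A B : cstar R) (X Y Z : corr A B) (U U' : X -> Y) (T T' : Y -> Z) :
  path_connected U U' -> path_connected T T' -> path_connected (T \o U) (T' \o U').
Proof.
move=> [w [hw w0 w1]] [v [hv v0 v1]]; exists (fun t => v t \o w t); split.
- split=> [t|x]; first exact: unitary_comp (upath_unitary hw t) (upath_unitary hv t).
  exact: path_apply_cont hv (mk_cpath (upath_cont hw x)).
- by move=> x /=; rewrite w0 v0.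
- by move=> x /=; rewrite w1 v1.
Qed.

Lemma path_connected_ext (A B : cstar R) (X Y : corr A B) (U U' T T' : X -> Y) :
  U =1 T -> U' =1 T' -> path_connected U U' -> path_connected T T'.
Proof.
move=> e e' [w [hw w0 w1]]; exists w; split=> // x; first by rewrite w0.
by rewrite w1.
Qed.

Section Graph.
Variables (V W : finType) (E : digraph V W).

(* A permutation of the edges is a product of transpositions exchanging
   parallel edges, and each of these is an involution. *)
Lemma perm_path_connected (s : {perm E}) (U : gcorr R E -> gcorr R E) :
  (forall e, gsrc (s e) = gsrc e) -> (forall e, grng (s e) = grng e) ->
  unitary U -> (forall e, U (delta R e) = delta R (s e)) -> path_connected id U.
Proof.
have [n] := ubnP #|[set e | s e != e]|.
elim: n => // n IH in s U *; rewrite ltnS => hn ss sr hU Ud.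
have [/existsP[x xs]|/existsPn s1] := boolP [exists x, s x != x]; last first.
  apply: path_connected_refl; first exact: unitary_id.
  apply: graph_unitary_eq hU _; first exact: unitary_id.
  by move=> e; rewrite Ud; have := s1 e; rewrite negbK => /eqP ->.
(* In the product [s] acts first, so [s'] fixes [x]; it moves no edge that [s] fixes. Since [s]
   preserves ends, [tau] exchanges parallel edges. *)
pose tau := tperm x (s x); pose s' := (s * tau)%g.
have taus e : gsrc (tau e) = gsrc e.
  by rewrite /tau; case: tpermP => [->|->|]; rewrite ?ss.
have taur e : grng (tau e) = grng e.
  by rewrite /tau; case: tpermP => [->|->|]; rewrite ?sr.
have s's e : gsrc (s' e) = gsrc e by rewrite permM taus.
have s'r e : grng (s' e) = grng e by rewrite permM taur.
have [T [hT Td]] := graph_iso_unitary R (Bijective (permK tau) (permKV tau)) taus taur.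
have [U' [hU' U'd]] := graph_iso_unitary R (Bijective (permK s') (permKV s')) s's s'r.
have TT : forall y, T (T y) = y.
  apply: (graph_unitary_eq (unitary_comp hT hT) (unitary_id _)) => e /=.
  by rewrite !Td tpermK.
have cU' : path_connected id U'.
  apply: (IH s') => //; apply: leq_trans hn; apply: proper_card.
  apply/properP; split.
    apply/fintype.subsetP => e; rewrite !inE permM; apply: contraNneq => se.
    rewrite se /tau tpermD //; apply: contraNneq xs; first by move=> ->; rewrite se.
    by move=> h; apply/eqP/(@perm_inj _ s); rewrite h se.
  by exists x; rewrite !inE // permM tpermR eqxx.
have cT : path_connected id T.
  exists (involution_path T); split.
  - exact: involution_path_unitary.
  - exact: involution_path0.
  - exact: involution_path1.
apply: path_connected_ext (path_connected_comp cU' cT) => //.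
apply: (graph_unitary_eq (unitary_comp hU' hT) hU) => e /=.
by rewrite U'd Td Ud permM tpermK.
Qed.

End Graph.

Lemma delta_inj (V W : finType) (E' : digraph V W) : injective (@delta R V W E').
Proof.
move=> e f /(congr1 (fun x : {ffun E' -> C} => x f)); rewrite !ffunE eqxx.
by case: eqP => [->//|_ /eqP]; rewrite eq_sym oner_eq0.
Qed.

(** The indicators of the ends of [e] fix [delta R e], hence also its image; on [delta R f] they
    would act by 0 if the ends differed. *)
Lemma monomial_src (V W : finType) (E F : digraph V W)
    (U : gcorr R E -> gcorr R F) e f :
  unitary U -> U (delta R e) = delta R f -> gsrc f = gsrc e /\ grng f = grng e.
Proof.
move=> hU Ue; split.
  have := unitary_lact hU (ind R (gsrc e)) (delta R e).
  rewrite lact_delta (unitaryZ hU) Ue lact_delta.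
  move/(congr1 (fun x : {ffun F -> C} => x f)); rewrite !ffunE !eqxx.
  by case: eqP => //= _ /eqP; rewrite -[_ == _]/((1 : C) * 1 == 0 * 1) mulr1 mul0r oner_eq0.
have := unitary_ract hU (delta R e) (ind R (grng e)).
rewrite ract_delta (unitaryZ hU) Ue ract_delta.
move/(congr1 (fun x : {ffun F -> C} => x f)); rewrite !ffunE !eqxx.
by case: eqP => //= _ /eqP; rewrite -[_ == _]/((1 : C) * 1 == 0 * 1) mulr1 mul0r oner_eq0.
Qed.

Section TwoGraphs.
Variables (V W : finType) (E F : digraph V W).

(** Otherwise [delta R f] would be orthogonal to the whole range of [U]. *)
Lemma monomial_surj (U : gcorr R E -> gcorr R F) f : unitary U ->
  (forall e, exists f, U (delta R e) = delta R f) -> exists e, U (delta R e) = delta R f.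
Proof.
move=> hU hd; apply: contrapT => nf.
have [z hz] := unitary_surj hU (delta R f).
have : ip (delta R f) (delta R f) = 0.
  rewrite -{2}hz [z]delta_sum (unitary_sum hU) ip_sumr big1 // => e _.
  have [g hg] := hd e; rewrite (unitaryZ hU) hg ipZr ip_delta ffunE.
  case: eqP => [fg|_]; last by rewrite scale0r scaler0.
  by case: nf; exists e; rewrite fg.
rewrite ip_delta ffunE eqxx scale1r => /(congr1 (fun x : {ffun W -> C} => x (grng f))).
by rewrite !ffunE eqxx => /eqP; rewrite oner_eq0.
Qed.

Lemma monomial_path_connected (U U' : gcorr R E -> gcorr R F) :
  unitary U -> unitary U' ->
  (forall e, exists f, U (delta R e) = delta R f) ->
  (forall e, exists f, U' (delta R e) = delta R f) -> path_connected U U'.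
Proof.
move=> hU hU' hd hd'.
have [Ui [hUi UK UiK]] := unitary_inv hU.
pose T := Ui \o U'; have hT : unitary T := unitary_comp hU' hUi.
have /choice [s hs] : forall e, exists e', T (delta R e) = delta R e'.
  move=> e; have [f hf] := hd' e; have [e' he'] := monomial_surj f hU hd.
  by exists e'; rewrite /T /= hf -he' UK.
have sinj : injective s.
  by move=> e e' h; apply/(@delta_inj _ _ E)/(unitary_inj hT); rewrite !hs h.
have cT : path_connected id T.
  apply: (@perm_path_connected _ _ _ (perm sinj) T) => // e; rewrite permE.
  - by have [] := monomial_src hT (hs e).
  - by have [] := monomial_src hT (hs e).
  - exact: hs.
apply: path_connected_ext (path_connected_comp cT (path_connected_refl hU (frefl U))) => //.
by move=> x /=; rewrite UiK.
Qed.

End TwoGraphs.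
End Monomial.

(** * 1-arrows exchanging edges *)

Section Frames.
Context (R : realType).
Local Notation C := R[i].

(** A finite Parseval frame, making the identity a finite sum of rank-one operators. Like
    [coframed], it is an identity that passes to paths through constant vectors, so properness and
    fullness there need no estimates. *)
Definition framed (A B : cstar R) (X : corr A B) : Prop :=
  exists s : seq X, forall z, z = \sum_(x <- s) ract x (ip x z).

Definition coframed (A B : cstar R) (X : corr A B) : Prop :=
  exists s : seq X, forall b, b = \sum_(x <- s) ip x (ract x b).

Lemma framed_proper (A B : cstar R) (X : corr A B) : framed X -> corr_proper X.
Proof.
move=> [s hs] a e e0; exists [seq (lact a x, x) | x <- s] => z.
rewrite [X in lact a X]hs lact_sumr big_map /=.
rewrite (eq_bigr (fun x => ract (lact a x) (ip x z))) ?subrr => [|x _].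
  by rewrite bnorm0 mulr_ge0 ?bnorm_ge0 ?(ltW e0).
exact: lact_ract.
Qed.

Lemma coframed_full (A B : cstar R) (X : corr A B) : coframed X -> corr_full X.
Proof.
move=> [s hs] b e e0; exists [seq (x, ract x b) | x <- s].
by rewrite big_map /= -hs subrr bnorm0.
Qed.

Lemma framed_const_path (A B : cstar R) (X : corr A B) :
  framed X -> framed (const_path_corr X).
Proof.
move=> [s hs]; exists [seq const_path x | x <- s] => z.
apply: (@cpath_ext _ X) => u; rewrite big_map cpath_sum.
exact: hs.
Qed.

Lemma coframed_const_path (A B : cstar R) (X : corr A B) :
  coframed X -> coframed (const_path_corr X).
Proof.
move=> [s hs]; exists [seq const_path x | x <- s] => z.
apply: (@cpath_ext _ B) => u; rewrite big_map cpath_sum.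
exact: hs.
Qed.

Section Graph.
Variables (V W : finType) (E : digraph V W).

Lemma framed_graph : framed (gcorr R E).
Proof.
exists [seq delta R e | e <- enum E] => z.
rewrite big_map big_enum [LHS]delta_sum; apply: eq_bigr => e _.
by rewrite ract_delta ip_delta !ffunE eqxx -[_ *: 1]/(_ * 1) mulr1.
Qed.

(** One edge into each vertex suffices: its inner square is the indicator of that vertex, and the
    indicators sum to 1. *)
Lemma coframed_graph : (forall w, exists e : E, grng e = w) -> coframed (gcorr R E).
Proof.
move=> /choice [f hf]; exists [seq delta R (f w) | w <- enum W] => b.
rewrite big_map big_enum.
rewrite (eq_bigr (fun w => (b : {ffun W -> C}) w *: ind R w)) => [|w _]; last first.
  by rewrite ract_delta ipZr ip_delta !ffunE eqxx scale1r !hf.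
apply/ffunP => w; rewrite sum_ffunE (bigD1 w) //= big1 ?addr0 => [|v vw].
  by rewrite !ffunE eqxx -[RHS]/(_ * 1) mulr1.
by rewrite !ffunE eq_sym (negPf vw) -[LHS]/(_ * 0) mulr0.
Qed.

Lemma nondegenerate_graph : corr_nondegenerate (gcorr R E).
Proof. by move=> x; exists (one_fun R V), x; rewrite lact1. Qed.

Lemma nondegenerate_const_path : corr_nondegenerate (const_path_corr (gcorr R E)).
Proof.
move=> x; exists (one_fun R V), x.
by apply: (@cpath_ext _ (gcorr R E)) => u; exact: esym (lact1 _).
Qed.

Lemma injective_graph : (forall v, exists e : E, gsrc e = v) -> corr_injective (gcorr R E).
Proof.
move=> h a ha; apply/ffunP => v; have [e <-] := h v.
have := ha (delta R e); rewrite lact_delta => /(congr1 (fun x : {ffun E -> C} => x e)).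
by rewrite !ffunE eqxx -[_ *: 1]/(_ * 1) mulr1.
Qed.

End Graph.
End Frames.

(** * Structure maps that permute edges *)

Section Swaps.
Context (R : realType).

(** The sense in which Phi permutes edges when modules are known only up to unitaries. No bijection
    is named, as unitarity of Phi takes care of injectivity; the conditions on the ends keep the
    output composable with further factors. *)
Definition swaps (V W1 W2 U : finType) (E : digraph V W1) (F : digraph W1 U)
    (F' : digraph V W2) (E' : digraph W2 U)
    (K : corr (fun_cstar R V) (fun_cstar R W1)) (L : corr (fun_cstar R W1) (fun_cstar R U))
    (L' : corr (fun_cstar R V) (fun_cstar R W2)) (K' : corr (fun_cstar R W2) (fun_cstar R U))
    (k : gcorr R E -> K) (l : gcorr R F -> L) (l' : gcorr R F' -> L') (k' : gcorr R E' -> K')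
    (Phi : tens K L -> tens L' K') : Prop :=
  forall e f, grng e = gsrc f -> exists f' e',
    [/\ grng f' = gsrc e', gsrc f' = gsrc e, grng e' = grng f &
      Phi (elt (k (delta R e)) (l (delta R f))) = elt (l' (delta R f')) (k' (delta R e'))].

Definition gpair (V W U : finType) (E : digraph V W) (F : digraph W U) (e : E) (f : F)
    (h : grng e = gsrc f) : gcomp E F :=
  exist (fun p => p \in [pred p : E * F | grng p.1 == gsrc p.2]) (e, f) (introT eqP h).

Section Homotopic.
Variables (V : finType) (E F : digraph V V).
Local Notation X := (@Obj R (fun_cstar R V) (gcorr R E)).

Lemma swaps_transition (G : arrow X X) (g : gcorr R F -> G) :
  unitary (@amap R X X G) -> unitary g -> swaps (E := E) (E' := E) id g g id (@amap R X X G) ->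
  exists (U : gcorr R (gcomp E F) -> gcorr R (gcomp F E)) (theta : gcorr R (gcomp F E) -> tens G X),
    [/\ unitary U, forall p, exists q, U (delta R p) = delta R q, unitary theta,
      forall y x, theta (graph_tensor y x) = @elt R _ _ _ G X (g y) x &
      forall x y, @amap R X X G (@elt R _ _ _ X G x (g y)) = theta (U (graph_tensor x y))].
Proof.
move=> hG hg sw.
have [th' [hth' th'e]] := graph_tens_unitary (unitary_id X) hg.
have [th [hth the]] := graph_tens_unitary hg (unitary_id X).
have [thi [hthi thK thiK]] := unitary_inv hth.
exists (thi \o @amap R X X G \o th'), th; split=> //.
- exact: unitary_comp hth' (unitary_comp hG hthi).
- move=> p; have pe : grng (val p).1 = gsrc (val p).2 by exact: eqP (valP p).
  have [f' [e' [h _ _ Phie]]] := sw _ _ pe.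
  exists (gpair h); apply: (can_inj thK).
  rewrite /= thiK -!graph_tensor_delta th'e the; exact: Phie.
- by move=> x y /=; rewrite thiK th'e.
Qed.

(** Modelling both arrows on the same graph [F] turns their structure maps into unitaries between
    the same two modules. The condition on [grng] makes the homotopy module full. *)
Lemma homotopic_swaps (G0 G1 : arrow X X) (g0 : gcorr R F -> G0) (g1 : gcorr R F -> G1) :
  unitary (@amap R X X G0) -> unitary g0 ->
  swaps (E := E) (E' := E) id g0 g0 id (@amap R X X G0) ->
  unitary (@amap R X X G1) -> unitary g1 ->
  swaps (E := E) (E' := E) id g1 g1 id (@amap R X X G1) ->
  (forall w, exists f : F, grng f = w) -> homotopic G0 G1.
Proof.
move=> hG0 hg0 sw0 hG1 hg1 sw1 Fr.
have [U0 [th0 [hU0 mU0 hth0 th0e U0e]]] := swaps_transition hG0 hg0 sw0.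
have [U1 [th1 [hU1 mU1 hth1 th1e U1e]]] := swaps_transition hG1 hg1 sw1.
have [w [hw w0 w1]] := monomial_path_connected hU0 hU1 mU0 mU1.
have [Phi [hPhi Phie]] := path_arrow_map_ex hw.
exists (@Arrow R X (path_obj X) (const_path_corr (gcorr R F)) Phi); split; [|split].
- split; first exact: nondegenerate_const_path.
  split; first exact/coframed_full/coframed_const_path/coframed_graph.
  split=> //; exact/framed_proper/framed_const_path/framed_graph.
- by apply: (path_arrow_2arrow hPhi Phie hG0 hg0 hth0 th0e) => x y; rewrite w0.
- by apply: (path_arrow_2arrow hPhi Phie hG1 hg1 hth1 th1e) => x y; rewrite w1.
Qed.

End Homotopic.
End Swaps.

(** * Counting edges *)

Section Counting.

Definition mxgraph (n p : nat) (A : 'M[nat]_(n, p)) : digraph 'I_n 'I_p :=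
  @Digraph _ _ (edge A) (fun e : edge A => (tag e).1) (fun e : edge A => (tag e).2).

Section Fiber.
Variables (V W : finType).

Definition fiber (E : digraph V W) v w := [pred e : E | (gsrc e == v) && (grng e == w)].

(** The edge listed k-th in its fiber goes to the k-th one of the corresponding fiber. The condition
    on [index] determines the map, which makes the two directions mutually inverse. *)
Lemma equinumerous_iso (E F : digraph V W) :
  (forall v w, #|fiber E v w| = #|fiber F v w|) ->
  exists f : E -> F, [/\ bijective f, forall e, gsrc (f e) = gsrc e &
    forall e, grng (f e) = grng e].
Proof.
have aux (E' F' : digraph V W) : (forall v w, #|fiber E' v w| = #|fiber F' v w|) ->
    exists f : E' -> F', forall e, [/\ gsrc (f e) = gsrc e, grng (f e) = grng e &
      index (f e) (enum (fiber F' (gsrc e) (grng e))) =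
      index e (enum (fiber E' (gsrc e) (grng e)))].
  move=> h; suff /choice [f hf] : forall e : E', exists f : F',
      [/\ gsrc f = gsrc e, grng f = grng e &
      index f (enum (fiber F' (gsrc e) (grng e))) =
      index e (enum (fiber E' (gsrc e) (grng e)))] by exists f.
  move=> e; set k := index e _.
  have ie : (k < size (enum (fiber F' (gsrc e) (grng e))))%N.
    by rewrite -cardE -h cardE index_mem mem_enum !inE !eqxx.
  have [f0 _] : exists f0, f0 \in enum (fiber F' (gsrc e) (grng e)).
    case: (enum _) ie => // f0 s _; exists f0; exact: mem_head.
  exists (nth f0 (enum (fiber F' (gsrc e) (grng e))) k).
  have := mem_nth f0 ie; rewrite mem_enum !inE => /andP[/eqP h1 /eqP h2].
  by split=> //; rewrite index_uniq ?enum_uniq.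
move=> h; have [f hf] := aux _ _ h; have [g hg] := aux F E (fun v w => esym (h v w)).
have can (E' F' : digraph V W) (u : E' -> F') (v : F' -> E') :
    (forall e, [/\ gsrc (u e) = gsrc e, grng (u e) = grng e &
      index (u e) (enum (fiber F' (gsrc e) (grng e))) =
      index e (enum (fiber E' (gsrc e) (grng e)))]) ->
    (forall e, [/\ gsrc (v e) = gsrc e, grng (v e) = grng e &
      index (v e) (enum (fiber E' (gsrc e) (grng e))) =
      index e (enum (fiber F' (gsrc e) (grng e)))]) -> cancel u v.
  move=> hu hv e; have [sf rf fi] := hu e; have [sg rg gi] := hv (u e).
  rewrite sf rf in sg rg gi; rewrite fi in gi.
  by apply: (index_inj e _ _ gi); rewrite mem_enum !inE ?sg ?rg !eqxx.
exists f; split=> [|e|e]; last 2 first.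
- by have [] := hf e.
- by have [] := hf e.
by exists g; [exact: can hf hg|exact: can hg hf].
Qed.

End Fiber.
Lemma card_fiber_gcomp (V W U : finType) (E : digraph V W) (F : digraph W U) v u :
  #|fiber (gcomp E F) v u| = (\sum_w #|fiber E v w| * #|fiber F w u|)%N.
Proof.
rewrite -sum1_card (partition_big (fun p : gcomp E F => grng (val p).1) xpredT) //=.
apply: eq_bigr => w _; rewrite -!sum1_card big_distrlr /= pair_big_dep /=.
transitivity (\sum_(p in [pred p : E * F | grng p.1 == gsrc p.2] |
  [&& gsrc p.1 == v, grng p.2 == u & grng p.1 == w]) 1)%N.
  rewrite (big_sub_cond [pred p : E * F | grng p.1 == gsrc p.2]
    (fun p => [&& gsrc p.1 == v, grng p.2 == u & grng p.1 == w]) (fun=> 1%N)).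
  by apply: eq_bigl => p; rewrite !inE andbA.
apply: eq_bigl => -[e f]; rewrite !inE /=.
case: (eqVneq (grng e) w) => [->|]; rewrite ?andbF //= !andbT [w == _]eq_sym.
by rewrite andbCA.
Qed.

Lemma card_fiber_mx (n p : nat) (A : 'M[nat]_(n, p)) i j : #|fiber (mxgraph A) i j| = A i j.
Proof.
rewrite -sum1_card.
transitivity (\sum_(vw : 'I_n * 'I_p | (vw.1 == i) && (vw.2 == j))
  \sum_(k : 'I_(A vw.1 vw.2)) 1)%N.
  rewrite (sig_big_dep (fun vw : 'I_n * 'I_p => (vw.1 == i) && (vw.2 == j))
    (fun vw (_ : 'I_(A vw.1 vw.2)) => true) (fun _ _ => 1%N)).
  by apply: eq_bigl => e; rewrite !inE andbT.
rewrite (big_pred1 (i, j)) => [|[v w]]; last by rewrite -xpair_eqE.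
by rewrite sum1_card card_ord.
Qed.

End Counting.

(** * Powers and composites *)

Section Arrows.
Context (R : realType).

Lemma graph_tens_delta (V W U : finType) (E : digraph V W) (F : digraph W U)
    (K : corr (fun_cstar R V) (fun_cstar R W)) (L : corr (fun_cstar R W) (fun_cstar R U))
    (g : gcorr R E -> K) (h : gcorr R F -> L) : unitary g -> unitary h ->
  exists theta : gcorr R (gcomp E F) -> tens K L, unitary theta /\
    forall p, theta (delta R p) = elt (g (delta R (val p).1)) (h (delta R (val p).2)).
Proof.
move=> hg hh; have [th [hth the]] := graph_tens_unitary hg hh.
by exists th; split=> // p; rewrite -graph_tensor_delta.
Qed.

Section Power.
Variables (V : finType) (E : digraph V V).
Local Notation X := (@Obj R (fun_cstar R V) (gcorr R E)).

(** Paths of n + 1 edges, bracketed to the left like [tpow]. *)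
Fixpoint gpow n : digraph V V := if n is n'.+1 then gcomp (gpow n') E else E.

(** The associativity identification regroups a path: its last edge becomes [e'] and all earlier
    edges form [f'], so it swaps edges in the required sense. *)
Lemma tpow_frame n : exists g : gcorr R (gpow n) -> tpow X n,
  [/\ unitary g, unitary (@tpow_map R X n) &
    swaps (E := E) (E' := E) (K := X) (K' := X) id g g id (@tpow_map R X n)].
Proof.
elim: n => [|n [g [hg hm sw]]].
  exists id; split; [exact: unitary_id|exact: unitary_id|].
  by move=> e f ef; exists e, f.
have [th [hth the]] := graph_tens_delta hg (unitary_id X).
have f1 : ftens X (tpow X n) := ftens_graph (unitary_id X) hg.
have f2 : ftens (tpow X n) X := ftens_graph hg (unitary_id X).
have [th1 [hth1 _]] := graph_tens_unitary (unitary_id X) hg.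
have f3 : ftens (tens X (tpow X n)) X := ftens_graph hth1 (unitary_id X).
have f4 : ftens X (tens (tpow X n) X) := ftens_graph (unitary_id X) hth.
have [a1 a2] := tens_assocVP f1 f2 f3 f4.
have [l1 l2] := tenslP f3 hm.
exists th; split=> //; first exact: unitary_comp a1 l1.
move=> e p ep; have pc : grng (val p).1 = gsrc (val p).2 by exact: eqP (valP p).
have [f' [e' [h1 h2 h3 h4]]] := sw e (val p).1 ep.
have h5 : grng e' = gsrc (val p).2 by rewrite h3.
exists (gpair h1), (val p).2; split=> //.
by rewrite the /= a2 l2 [tpow_map _]h4 the.
Qed.

End Power.

Section Composite.
Variables (V W U : finType) (EZ : digraph U U) (EY : digraph W W) (EX : digraph V V).
Local Notation Z := (@Obj R (fun_cstar R U) (gcorr R EZ)).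
Local Notation Y := (@Obj R (fun_cstar R W) (gcorr R EY)).
Local Notation X := (@Obj R (fun_cstar R V) (gcorr R EX)).
Variables (G : digraph U W) (F : digraph W V).
Variables (Phi : tens Z (gcorr R G) -> tens (gcorr R G) Y).
Variables (Psi : tens Y (gcorr R F) -> tens (gcorr R F) X).
Hypotheses (hPhi : unitary Phi) (hPsi : unitary Psi).
Hypothesis swPhi : swaps (E := EZ) (E' := EY) (F := G) (F' := G)
  (K := Z) (K' := Y) id id id id Phi.
Hypothesis swPsi : swaps (E := EY) (E' := EX) (F := F) (F' := F)
  (K := Y) (K' := X) id id id id Psi.

Local Notation GF := (arrow_comp (@Arrow R Z Y (gcorr R G) Phi) (@Arrow R Y X (gcorr R F) Psi)).

(** The composite pushes [e] first past the edge of [G], giving [r'] and [b], then pushes [b] past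
    the edge of [F], giving [s'] and [e']. The auxiliary unitaries only secure the existence of the
    tensor products passed through. *)
Lemma arrow_comp_frame : exists g : gcorr R (gcomp G F) -> GF,
  [/\ unitary g, unitary (@amap R _ _ GF) &
    swaps (E := EZ) (E' := EX) (K := Z) (K' := X) id g g id (@amap R _ _ GF)].
Proof.
have u := unitary_id.
have [th [hth the]] := graph_tens_delta (u _ _ _ (gcorr R G)) (u _ _ _ (gcorr R F)).
have [thZ [hthZ _]] := graph_tens_delta (u _ _ _ Z) (u _ _ _ (gcorr R G)).
have [thY [hthY _]] := graph_tens_delta (u _ _ _ (gcorr R G)) (u _ _ _ Y).
have [thY' [hthY' _]] := graph_tens_delta (u _ _ _ Y) (u _ _ _ (gcorr R F)).
have [thX [hthX _]] := graph_tens_delta (u _ _ _ (gcorr R F)) (u _ _ _ X).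
have [a1 a2] := tens_assocVP (ftens_graph (u _ _ _ Z) (u _ _ _ (gcorr R G)))
  (ftens_graph (u _ _ _ (gcorr R G)) (u _ _ _ (gcorr R F)))
  (ftens_graph hthZ (u _ _ _ (gcorr R F))) (ftens_graph (u _ _ _ Z) hth).
have [b1 b2] := tenslP (ftens_graph hthZ (u _ _ _ (gcorr R F))) hPhi.
have [c1 c2] := tens_assocP (ftens_graph (u _ _ _ (gcorr R G)) (u _ _ _ Y))
  (ftens_graph (u _ _ _ Y) (u _ _ _ (gcorr R F)))
  (ftens_graph hthY (u _ _ _ (gcorr R F))) (ftens_graph (u _ _ _ (gcorr R G)) hthY').
have [d1 d2] := tensrP (ftens_graph (u _ _ _ (gcorr R G)) hthY') hPsi.
have [e1 e2] := tens_assocVP (ftens_graph (u _ _ _ (gcorr R G)) (u _ _ _ (gcorr R F)))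
  (ftens_graph (u _ _ _ (gcorr R F)) (u _ _ _ X))
  (ftens_graph hth (u _ _ _ X)) (ftens_graph (u _ _ _ (gcorr R G)) hthX).
exists th; split=> //.
  exact: unitary_comp a1 (unitary_comp b1 (unitary_comp c1 (unitary_comp d1 e1))).
move=> e p ep; have pc : grng (val p).1 = gsrc (val p).2 by exact: eqP (valP p).
have [r' [b [h1 h2 h3 h4]]] := swPhi ep.
have bs : grng b = gsrc (val p).2 by rewrite h3.
have [s' [e' [k1 k2 k3 k4]]] := swPsi bs.
have rs : grng r' = gsrc s' by rewrite h1 k2.
exists (gpair rs), e'; split=> //.
rewrite the /= /arrow_comp_map a2 [tensl _ _]b2 h4 c2 [tensr _ _]d2 k4 e2.
by rewrite the.
Qed.

End Composite.

(** The hypothesis is the matrix identity B S = S A, entry by entry, as a count of paths; the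
    bijection is otherwise arbitrary. *)
Lemma arrow_exists (V W : finType) (EX : digraph V V) (EY : digraph W W) (F : digraph W V) :
  (forall w v, #|fiber (gcomp EY F) w v| = #|fiber (gcomp F EX) w v|) ->
  exists Phi : tens (gcorr R EY) (gcorr R F) -> tens (gcorr R F) (gcorr R EX),
    unitary Phi /\ swaps (E := EY) (E' := EX) (F := F) (F' := F) id id id id Phi.
Proof.
move=> /equinumerous_iso[f [fb fs fr]].
have [P [hP Pd]] := graph_iso_unitary R fb fs fr.
have [th [hth the]] := graph_tens_delta (unitary_id (gcorr R EY)) (unitary_id (gcorr R F)).
have [th' [hth' the']] := graph_tens_delta (unitary_id (gcorr R F)) (unitary_id (gcorr R EX)).
have [thi [hthi thK _]] := unitary_inv hth.
exists (th' \o P \o thi); split; first exact: unitary_comp hthi (unitary_comp hP hth').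
move=> e r er; exists (val (f (gpair er))).1, (val (f (gpair er))).2; split.
- exact: eqP (valP (f (gpair er))).
- exact: fs (gpair er).
- exact: fr (gpair er).
by rewrite /= -(the (gpair er)) thK Pd the'.
Qed.

(** M (x) N is modelled on pairs of edges and the power on paths; this moves the swapping property
    to a common graph. *)
Lemma swaps_reindex (V : finType) (E F F' : digraph V V)
    (G : arrow (@Obj R (fun_cstar R V) (gcorr R E)) (@Obj R (fun_cstar R V) (gcorr R E)))
    (g : gcorr R F -> G) (f : F' -> F) (U : gcorr R F' -> gcorr R F) :
  bijective f -> (forall e, gsrc (f e) = gsrc e) -> (forall e, grng (f e) = grng e) ->
  (forall e, U (delta R e) = delta R (f e)) ->
  swaps (E := E) (E' := E) id g g id (@amap R _ _ G) ->
  swaps (E := E) (E' := E) id (g \o U) (g \o U) id (@amap R _ _ G).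
Proof.
move=> [f' fK f'K] fs fr Ud sw e h eh.
have [|h' [e' [k1 k2 k3 k4]]] := sw e (f h); first by rewrite fs.
exists (f' h'), e'; split=> //.
- by rewrite -fr f'K.
- by rewrite -fs f'K.
- by rewrite k3 fr.
- by rewrite /= !Ud f'K.
Qed.

End Arrows.

(** * Essential matrices *)

Section Essential.

Definition no_zero_col (n p : nat) (A : 'M[nat]_(n, p)) := forall j, exists i, A i j != 0.

Lemma mulmx_nat (n p q : nat) (A : 'M[nat]_(n, p)) (B : 'M[nat]_(p, q)) i k :
  (A *m B) i k = (\sum_j A i j * B j k)%N.
Proof. by rewrite mxE. Qed.

Lemma no_zero_colM (n p q : nat) (A : 'M[nat]_(n, p)) (B : 'M[nat]_(p, q)) :
  no_zero_col A -> no_zero_col B -> no_zero_col (A *m B).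
Proof.
move=> hA hB k; have [j hj] := hB k; have [i hi] := hA j; exists i.
rewrite mulmx_nat -lt0n (bigD1 j) //= addn_gt0 muln_gt0 !lt0n.
by apply/orP; left; apply/andP.
Qed.

Lemma no_zero_col_mulr (n p q : nat) (A : 'M[nat]_(n, p)) (B : 'M[nat]_(p, q)) :
  no_zero_col (A *m B) -> no_zero_col B.
Proof.
move=> h k; have [i Hi] := h k; apply: contrapT => nj; case/negP: Hi; apply/eqP.
rewrite mulmx_nat big1 // => j _; have [->|Bj] := eqVneq (B j k) 0; first exact: muln0.
by case: nj; exists j.
Qed.

Lemma no_zero_colX (n : nat) (A : 'M[nat]_n) m : no_zero_col A -> no_zero_col (A ^+ m.+1).
Proof.
move=> hA; elim: m => [|m IH]; first by rewrite expr1.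
by rewrite exprSr; exact: no_zero_colM.
Qed.

Lemma essential_no_zero_col (n : nat) (A : 'M[nat]_n) : essential A -> no_zero_col A.
Proof.
move=> [_ hc] j; apply: contrapT => h; have /eqP := hc j; apply.
apply/matrixP => i k; rewrite !mxE; apply/eqP; rewrite -[_ == _]negbK.
by apply/negP => hi; apply: h; exists i.
Qed.

Lemma essential_row (n : nat) (A : 'M[nat]_n) : essential A -> forall i, exists j, A i j != 0.
Proof.
move=> [hr _] i; apply: contrapT => h; have /eqP := hr i; apply.
apply/matrixP => k j; rewrite !mxE; apply/eqP; rewrite -[_ == _]negbK.
by apply/negP => hi; apply: h; exists j.
Qed.

Lemma fiber_edge (V W : finType) (E : digraph V W) v w :
  #|fiber E v w| != 0 -> exists e : E, gsrc e = v /\ grng e = w.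
Proof.
by rewrite -lt0n => /card_gt0P[e]; rewrite inE => /andP[/eqP h1 /eqP h2]; exists e.
Qed.

Lemma mxgraph_rng (n p : nat) (A : 'M[nat]_(n, p)) : no_zero_col A ->
  forall w, exists e : mxgraph A, grng e = w.
Proof.
move=> h w; have [v] := h w; rewrite -card_fiber_mx => /fiber_edge[e [_ ew]].
by exists e.
Qed.

Lemma card_fiber_gcomp_mx (n p q : nat) (A : 'M[nat]_(n, p)) (B : 'M[nat]_(p, q)) i k :
  #|fiber (gcomp (mxgraph A) (mxgraph B)) i k| = (A *m B) i k.
Proof.
rewrite card_fiber_gcomp mulmx_nat; apply: eq_bigr => j _.
by rewrite !card_fiber_mx.
Qed.

Lemma card_fiber_gpow (n : nat) (A : 'M[nat]_n) m i k :
  #|fiber (gpow (mxgraph A) m) i k| = (A ^+ m.+1) i k.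
Proof.
elim: m i k => [|m IH] i k; first by rewrite card_fiber_mx expr1.
rewrite card_fiber_gcomp exprSr [RHS]mulmx_nat; apply: eq_bigr => j _.
by rewrite IH card_fiber_mx.
Qed.

End Essential.

(** * The homotopy shift equivalence *)

Section Main.
Context (R : realType).

(** Nonzero columns give fullness, nonzero rows injectivity of the left action. *)
Lemma graph_is_obj (n : nat) (A : 'M[nat]_n) : essential A -> is_obj (graph_obj R A).
Proof.
move=> hA; split; first exact: (@nondegenerate_graph R _ _ (mxgraph A)).
split.
  apply/(@coframed_full _ _ _ (gcorr R (mxgraph A)))/coframed_graph/mxgraph_rng.
  exact: essential_no_zero_col.
split; last exact/(@framed_proper _ _ _ (gcorr R (mxgraph A)))/framed_graph.
apply: (@injective_graph R _ _ (mxgraph A)) => v.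
have [w] := essential_row hA v; rewrite -card_fiber_mx => /fiber_edge[e [ev _]].
by exists e.
Qed.

Lemma graph_is_arrow (n p : nat) (A : 'M[nat]_n) (B : 'M[nat]_p) (S : 'M[nat]_(p, n))
    (Phi : tens (gcorr R (mxgraph B)) (gcorr R (mxgraph S)) ->
           tens (gcorr R (mxgraph S)) (gcorr R (mxgraph A))) :
  no_zero_col S -> unitary Phi ->
  is_arrow (@Arrow R (graph_obj R B) (graph_obj R A) (gcorr R (mxgraph S)) Phi).
Proof.
move=> hS hPhi; split; first exact: nondegenerate_graph.
split; first exact/coframed_full/coframed_graph/mxgraph_rng.
by split=> //; exact/framed_proper/framed_graph.
Qed.

Lemma homotopic_comp_pow (n p m : nat) (A : 'M[nat]_n) (B : 'M[nat]_p)
    (S : 'M[nat]_(n, p)) (T : 'M[nat]_(p, n))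
    (Phi : tens (gcorr R (mxgraph A)) (gcorr R (mxgraph S)) ->
           tens (gcorr R (mxgraph S)) (gcorr R (mxgraph B)))
    (Psi : tens (gcorr R (mxgraph B)) (gcorr R (mxgraph T)) ->
           tens (gcorr R (mxgraph T)) (gcorr R (mxgraph A))) :
  no_zero_col A -> A ^+ m.+1 = S *m T -> unitary Phi -> unitary Psi ->
  swaps (E := mxgraph A) (E' := mxgraph B) (F := mxgraph S) (F' := mxgraph S) id id id id Phi ->
  swaps (E := mxgraph B) (E' := mxgraph A) (F := mxgraph T) (F' := mxgraph T) id id id id Psi ->
  homotopic
    (arrow_comp (@Arrow R (graph_obj R A) (graph_obj R B) (gcorr R (mxgraph S)) Phi)
                (@Arrow R (graph_obj R B) (graph_obj R A) (gcorr R (mxgraph T)) Psi))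
    (pow_arrow (graph_obj R A) m.+1).
Proof.
move=> hA e hPhi hPsi sPhi sPsi.
have [g [hg hGF swg]] := arrow_comp_frame hPhi hPsi sPhi sPsi.
have [g1 [hg1 hpow swg1]] := tpow_frame R (mxgraph A) m.
(* [gpow _ m] has paths of m + 1 edges, counted by the entries of A^(m+1) = S T. *)
have [|f [fb fs fr]] := @equinumerous_iso _ _ (gpow (mxgraph A) m)
    (gcomp (mxgraph S) (mxgraph T)).
  by move=> v w; rewrite card_fiber_gpow card_fiber_gcomp_mx e.
have [U [hU Ud]] := graph_iso_unitary R fb fs fr.
have col w : exists f : gpow (mxgraph A) m, grng f = w.
  have [v] := no_zero_colX m hA w; rewrite -card_fiber_gpow => /fiber_edge[q [_ qw]].
  by exists q.
pose G1 := pow_arrow (@Obj R (fun_cstar R 'I_n) (gcorr R (mxgraph A))) m.+1.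
exact: (@homotopic_swaps R _ (mxgraph A) _ _ G1 _ g1
  hGF (unitary_comp hU hg) (swaps_reindex fb fs fr Ud swg) hpow hg1 swg1 col).
Qed.

End Main.

Theorem proposition4p3 (R : realType) (n p m : nat)
    (A : 'M[nat]_n) (B : 'M[nat]_p) :
  essential A -> essential B -> shift_equivalent m A B ->
  homotopy_shift_equivalent m (graph_obj R A) (graph_obj R B).
Proof.
move=> hA hB [m0 [S [T [eA eB eBT eAS]]]].
(* [pow_arrow] takes the predecessor of the lag, so lag m + 1 matches [tpow _ m] and [gpow _ m]. *)
case: m m0 eA eB => // m _ eA eB.
have cA := essential_no_zero_col hA; have cB := essential_no_zero_col hB.
(* For fullness of M and N: a zero column of [S] would be one of T S = B^(m+1), and likewise for
   [T]. *)
have cS : no_zero_col S.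
  by apply: (@no_zero_col_mulr _ _ _ T); rewrite -eB; exact: no_zero_colX.
have cT : no_zero_col T.
  by apply: (@no_zero_col_mulr _ _ _ S); rewrite -eA; exact: no_zero_colX.
split=> //; [exact: graph_is_obj|exact: graph_is_obj|].
have [|Phi [hPhi sPhi]] := arrow_exists R (EX := mxgraph B) (EY := mxgraph A) (F := mxgraph S).
  by move=> v w; rewrite !card_fiber_gcomp_mx eAS.
have [|Psi [hPsi sPsi]] := arrow_exists R (EX := mxgraph A) (EY := mxgraph B) (F := mxgraph T).
  by move=> v w; rewrite !card_fiber_gcomp_mx eBT.
exists (@Arrow R (graph_obj R A) (graph_obj R B) (gcorr R (mxgraph S)) Phi).
exists (@Arrow R (graph_obj R B) (graph_obj R A) (gcorr R (mxgraph T)) Psi).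
split; [exact: graph_is_arrow|exact: graph_is_arrow| |].
- exact: homotopic_comp_pow.
- exact: homotopic_comp_pow.
Qed.
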